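(* Let $n\ge1$. There is a well defined homomorphism of $\mathbb C(q)$-algebras $$\varphi_1:U_q(A_2^{(2)})\to U_q^{(1)}\subseteq U_q(A_{2n}^{(2)})$$ given on the generators by $\varphi_1(E_1)=E_1$, $\varphi_1(F_1)=F_1$, $\varphi_1(K_1^{\pm1})=K_1^{\pm1}$, $\varphi_1(E_0)=E_{\delta-2\alpha_1}$, $\varphi_1(F_0)=F_{\delta-2\alpha_1}$, $\varphi_1(K_0^{\pm1})=K_{\delta-2\alpha_1}^{\pm1}$. (That is: these assignments respect the defining relations of $U_q(A_2^{(2)})$ and the images lie in the subalgebra $U_q^{(1)}$.)
   Context: $[m]_v=\frac{v^m-v^{-m}}{v-v^{-1}}$, $[m]_v!=\prod_{s=1}^m[s]_v$. **$U_q(A_2^{(2)})$** is the $\mathbb C(q)$-algebra generated by $E_i,F_i,K_i^{\pm1}$ ($i=0,1$) with relations $K_0K_1=K_1K_0$; $K_1E_1=q^2E_1K_1$, $K_1E_0=q^{-4}E_0K_1$, $K_0E_1=q^{-4}E_1K_0$, $K_0E_0=q^8E_0K_0$; the same with $E$ replaced by $F$ and $q$ by $q^{-1}$; $[E_1,F_1]=\frac{K_1-K_1^{-1}}{q-q^{-1}}$, $[E_0,F_0]=\frac{K_0-K_0^{-1}}{q^4-q^{-4}}$, $[E_1,F_0]=0=[E_0,F_1]$; $\sum_{r=0}^2(-1)^rE_0^{(r)}E_1E_0^{(2-r)}=0=\sum_{r=0}^5(-1)^rE_1^{(r)}E_0E_1^{(5-r)}$ and the same with $F$ in place of $E$, where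 $X_1^{(m)}=X_1^m/[m]_q!$, $X_0^{(m)}=X_0^m/[m]_{q^4}!$. **$U_q(A_{2n}^{(2)})$.** The diagram has vertices $I=\{0,1,\dots,n\}$ and is the path $1$–$2$–$\cdots$–$n$–$0$; $d_1=1$, $d_2=\dots=d_n=2$, $d_0=4$; $a_{ii}=2$, $d_ia_{ij}=-\max(d_i,d_j)$ for adjacent $i\neq j$, $a_{ij}=0$ otherwise; $q_i=q^{d_i}$; $Q=\oplus_{i\in I}\mathbb Z\alpha_i$, $(\alpha_i|\alpha_j)=d_ia_{ij}$, $s_i(\alpha_j)=\alpha_j-a_{ij}\alpha_i$, $\delta=\alpha_0+2(\alpha_1+\dots+\alpha_n)$. $U_q(A_{2n}^{(2)})$ is the $\mathbb C(q)$-algebra generated by $E_i,F_i,K_i^{\pm1}$ ($i\in I$; together, in the full algebra, with an invertible $D=K_\infty$ satisfying $DE_i=q^{4\delta_{i0}}E_iD$, $DF_i=q^{-4\delta_{i0}}F_iD$ and commuting with the $K_i$, which plays no role here) with relations: the $K$'s commute, $K_\lambda E_i=q^{(\lambda|\alpha_i)}E_iK_\lambda$, $K_\lambda F_i=q^{-(\lambda|\alpha_i)}F_iK_\lambda$ where $K_\lambda=\prod K_i^{m_i}$ for $\lambda=\sum m_i\alpha_i$, $[E_i,F_j]=\delta_{ij}\frac{K_i-K_i^{-1}}{q_i-q_i^{-1}}$, $\sum_{r=0}^{1-a_{ij}}(-1)^rE_i^{(r)}E_jE_i^{(1-a_{ij}-r)}=0$ for $i\ne j$ and likewise for $F$, with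 $E_i^{(m)}=E_i^m/[m]_{q_i}!$. $\Omega$ is the $\mathbb C$-antilinear anti-involution with $E_i\leftrightarrow F_i$, $K_i\mapsto K_i^{-1}$, $q\mapsto q^{-1}$. The braid group acts by automorphisms $T_i$ commuting with $\Omega$: $T_i(K_\lambda)=K_{s_i\lambda}$, $T_i(E_i)=-F_iK_i$, $T_i(E_j)=\sum_{r=0}^{-a_{ij}}(-1)^{r-a_{ij}}q_i^{-r}E_i^{(-a_{ij}-r)}E_jE_i^{(r)}$ for $j\ne i$. **Root vectors used.** Put $T_w=T_0T_nT_{n-1}\cdots T_1$ and $T_{\omega_1}=T_w^n$ (here $w=s_0s_n\cdots s_1$, $\omega_1=w^n$). Then $E_{\delta-2\alpha_1}=T_w^{n-1}(E_0)$, $E_{\delta-\alpha_1}=T_{\omega_1}T_1^{-1}(E_1)$, $F_{\delta-2\alpha_1}=\Omega(E_{\delta-2\alpha_1})$, $F_{\delta-\alpha_1}=\Omega(E_{\delta-\alpha_1})$. $U_q^{(1)}$ is the $\mathbb C(q)$-subalgebra of $U_q(A_{2n}^{(2)})$ generated by $E_1,E_{\delta-\alpha_1},F_1,F_{\delta-\alpha_1},K_1^{\pm1},K_\delta^{\pm1}$. *)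

(* Defs.v *)
From HB Require Import structures.
From mathcomp Require Import all_boot all_order all_algebra.
From mathcomp Require Import boolp reals.
From mathcomp Require Import complex.
From mathcomp Require Import monalg.
From mathcomp Require finmap.

Set Implicit Arguments.
Unset Strict Implicit.
Unset Printing Implicit Defensive.

Import Order.TTheory GRing.Theory Num.Theory.
Local Open Scope ring_scope.
Local Open Scope quotient_scope.

Notation freeAlg k X := {malg k[{fmonom X}]}.

Section FreeAlgebra.
Variables (k : fieldType) (X : choiceType).
Local Notation free := (freeAlg k X).

Definition fgen (x : X) : free := << fmu x >>.

Inductive ideal_gen (rel : free -> free -> Prop) : free -> Prop :=
| ideal_gen0 : ideal_gen rel 0
| ideal_genD a b l r x :
    rel l r -> ideal_gen rel x -> ideal_gen rel (a * (l - r) * b + x).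

Lemma ideal_gen_add rel x y :
  ideal_gen rel x -> ideal_gen rel y -> ideal_gen rel (x + y).
Proof.
move=> hx hy; elim: hx => [|a b l r z hr _ IH]; first by rewrite add0r.
by rewrite -addrA; exact: ideal_genD.
Qed.

Lemma ideal_gen_mull rel c x : ideal_gen rel x -> ideal_gen rel (c * x).
Proof.
elim=> [|a b l r z hr _ IH]; first by rewrite mulr0; exact: ideal_gen0.
by rewrite mulrDr !mulrA; exact: ideal_genD.
Qed.

Lemma ideal_gen_mulr rel c x : ideal_gen rel x -> ideal_gen rel (x * c).
Proof.
elim=> [|a b l r z hr _ IH]; first by rewrite mul0r; exact: ideal_gen0.
by rewrite mulrDl -!mulrA mulrA; exact: ideal_genD.
Qed.

Lemma ideal_gen_opp rel x : ideal_gen rel x -> ideal_gen rel (- x).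
Proof. by rewrite -mulN1r; exact: ideal_gen_mull. Qed.

Lemma ideal_gen_rel rel l r : rel l r -> ideal_gen rel (l - r).
Proof.
move=> h; have := ideal_genD 1 1 h (ideal_gen0 rel).
by rewrite mul1r mulr1 addr0.
Qed.

Section Eval.
Variables (A : algType k) (f : X -> A).

Definition fmon_eval (m : {fmonom X}) : A := \prod_(x <- m) f x.

Lemma fmon_eval_is_mmorphism : mmorphism fmon_eval.
Proof.
split=> [m1 m2|]; rewrite /fmon_eval.
  by rewrite fmM big_cat.
by rewrite fm1 big_nil.
Qed.

HB.instance Definition _ :=
  isMultiplicative.Build {fmonom X} A fmon_eval fmon_eval_is_mmorphism.

Definition feval : free -> A := mmap (in_alg A) fmon_eval.

HB.instance Definition _ := GRing.Additive.on feval.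

Lemma feval_is_monoid_morphism : monoid_morphism feval.
Proof.
have [hM h1] : multiplicative feval.
  apply: commr_mmap_is_multiplicative => g m m'.
  by rewrite /GRing.comm /= mulr_algl mulr_algr.
by split.
Qed.

HB.instance Definition _ :=
  GRing.isMonoidMorphism.Build free A feval feval_is_monoid_morphism.

Lemma feval_is_scalable : scalable feval.
Proof. by move=> c x; rewrite /feval mmapZ /= mulr_algl. Qed.

HB.instance Definition _ :=
  GRing.isScalable.Build k free A *:%R feval feval_is_scalable.

Lemma feval_gen x : feval (fgen x) = f x.
Proof.
by rewrite /feval /fgen mmapU /= scale1r mul1r /fmon_eval fmU big_seq1.
Qed.

Lemma feval_ideal (rel : free -> free -> Prop) :
  (forall l r, rel l r -> feval l = feval r) ->
  forall x, ideal_gen rel x -> feval x = 0.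
Proof.
move=> hrel x; elim=> [|a b l r z hr _ IH]; first exact: rmorph0.
by rewrite rmorphD !rmorphM rmorphB /= (hrel _ _ hr) subrr mulr0 mul0r add0r.
Qed.

End Eval.
End FreeAlgebra.

(* [algType] only contains non-zero algebras, hence the properness condition;
   it is established below by means of the counit. *)
Record presentation (k : fieldType) := Presentation {
  pgens : choiceType;
  prel : freeAlg k pgens -> freeAlg k pgens -> Prop;
  pproper : ~ ideal_gen prel 1 }.

Section PresentedAlgebra.
Variables (k : fieldType) (P : presentation k).
Local Notation free := (freeAlg k (pgens P)).

Definition peqv (x y : free) : bool := `[< ideal_gen (@prel k P) (x - y) >].

Lemma peqv_equiv : equiv_class_of peqv.
Proof.
split=> [x|x y|y x z].
- by apply/asboolP; rewrite subrr; exact: ideal_gen0.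
- by apply/asboolP/asboolP => /ideal_gen_opp; rewrite opprB.
- move=> /asboolP h1 /asboolP h2; apply/asboolP.
  by have := ideal_gen_add h1 h2; rewrite addrA subrK.
Qed.

Canonical peqv_rel := EquivRelPack peqv_equiv.

Definition presAlg : Type := {eq_quot peqv}.

HB.instance Definition _ := Choice.on presAlg.
HB.instance Definition _ := EqQuotient.on presAlg.

Lemma pi_eqP (x y : free) :
  (\pi_presAlg x = \pi_presAlg y) <-> ideal_gen (@prel k P) (x - y).
Proof.
split=> [/eqmodP/asboolP //|h]; by apply/eqmodP/asboolP.
Qed.

Lemma presW (Q : presAlg -> Prop) :
  (forall x, Q (\pi_presAlg x)) -> forall x, Q x.
Proof. exact: quotW. Qed.

Let lift1 (f : free -> free) (x : presAlg) : presAlg := \pi_presAlg (f (repr x)).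
Let lift2 (f : free -> free -> free) (x y : presAlg) : presAlg :=
  \pi_presAlg (f (repr x) (repr y)).

Definition pzero : presAlg := \pi_presAlg 0.
Definition pone : presAlg := \pi_presAlg 1.
Definition popp : presAlg -> presAlg := lift1 -%R.
Definition padd : presAlg -> presAlg -> presAlg := lift2 +%R.
Definition pmul : presAlg -> presAlg -> presAlg := lift2 *%R.
Definition pscale (c : k) : presAlg -> presAlg := lift1 ( *:%R c).

Let reprP (x : free) :
  ideal_gen (@prel k P) (repr (\pi_presAlg x) - x).
Proof. by apply/pi_eqP; rewrite reprK. Qed.

Lemma pi_oppE x : popp (\pi_presAlg x) = \pi_presAlg (- x).
Proof.
apply/pi_eqP; rewrite opprK addrC -opprB.
by apply: ideal_gen_opp; exact: reprP.
Qed.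

Lemma pi_addE x y : padd (\pi_presAlg x) (\pi_presAlg y) = \pi_presAlg (x + y).
Proof. by apply/pi_eqP; rewrite opprD addrACA; apply: ideal_gen_add. Qed.

Lemma pi_mulE x y : pmul (\pi_presAlg x) (\pi_presAlg y) = \pi_presAlg (x * y).
Proof.
apply/pi_eqP; set x' := repr _; set y' := repr _.
have -> : x' * y' - x * y = (x' - x) * y' + x * (y' - y).
  by rewrite mulrBl mulrBr addrA subrK.
by apply: ideal_gen_add; [apply: ideal_gen_mulr|apply: ideal_gen_mull];
   exact: reprP.
Qed.

Lemma pi_scaleE c x : pscale c (\pi_presAlg x) = \pi_presAlg (c *: x).
Proof.
apply/pi_eqP; rewrite -scalerBr -mul_malgC.
by apply: ideal_gen_mull; exact: reprP.
Qed.

Lemma paddA : associative padd.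
Proof. by elim/presW=> x; elim/presW=> y; elim/presW=> z; rewrite !pi_addE addrA. Qed.
Lemma paddC : commutative padd.
Proof. by elim/presW=> x; elim/presW=> y; rewrite !pi_addE addrC. Qed.
Lemma padd0 : left_id pzero padd.
Proof. by elim/presW=> x; rewrite pi_addE add0r. Qed.
Lemma paddN : left_inverse pzero popp padd.
Proof. by elim/presW=> x; rewrite pi_oppE pi_addE addNr. Qed.

HB.instance Definition _ := GRing.isZmodule.Build presAlg paddA paddC padd0 paddN.

Lemma pmulA : associative pmul.
Proof. by elim/presW=> x; elim/presW=> y; elim/presW=> z; rewrite !pi_mulE mulrA. Qed.
Lemma pmul1 : left_id pone pmul.
Proof. by elim/presW=> x; rewrite pi_mulE mul1r. Qed.
Lemma pmulr1 : right_id pone pmul.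
Proof. by elim/presW=> x; rewrite pi_mulE mulr1. Qed.
Lemma pmulDl : left_distributive pmul padd.
Proof.
by elim/presW=> x; elim/presW=> y; elim/presW=> z;
   rewrite !(pi_mulE, pi_addE) mulrDl.
Qed.
Lemma pmulDr : right_distributive pmul padd.
Proof.
by elim/presW=> x; elim/presW=> y; elim/presW=> z;
   rewrite !(pi_mulE, pi_addE) mulrDr.
Qed.
Lemma pone_neq0 : pone != 0.
Proof. by apply/eqP => /pi_eqP; rewrite subr0; exact: pproper. Qed.

HB.instance Definition _ := GRing.Zmodule_isNzRing.Build presAlg
  pmulA pmul1 pmulr1 pmulDl pmulDr pone_neq0.

Lemma pscaleA a b x : pscale a (pscale b x) = pscale (a * b) x.
Proof. by elim/presW: x => x; rewrite !pi_scaleE scalerA. Qed.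
Lemma pscale1 : left_id 1 pscale.
Proof. by elim/presW=> x; rewrite pi_scaleE scale1r. Qed.
Lemma pscaleDr : right_distributive pscale +%R.
Proof.
by move=> c; elim/presW=> x; elim/presW=> y;
   rewrite /GRing.add /= !(pi_scaleE, pi_addE) scalerDr.
Qed.
Lemma pscaleDl x : {morph pscale^~ x : a b / a + b}.
Proof.
move=> a b; elim/presW: x => x.
by rewrite {2}/GRing.add /= !(pi_scaleE, pi_addE) scalerDl.
Qed.

HB.instance Definition _ := GRing.Zmodule_isLmodule.Build k presAlg
  pscaleA pscale1 pscaleDr pscaleDl.

Lemma pscaleAl c (x y : presAlg) : c *: (x * y) = (c *: x) * y.
Proof.
by elim/presW: x => x; elim/presW: y => y;
   rewrite /GRing.mul /GRing.scale /= !(pi_scaleE, pi_mulE) scalerAl.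
Qed.

HB.instance Definition _ := GRing.Lmodule_isLalgebra.Build k presAlg pscaleAl.

Lemma free_scalerAr (c : k) (x y : free) : c *: (x * y) = x * (c *: y).
Proof.
rewrite -!mul_malgC mulrA [RHS]mulrA; congr (_ * y).
rewrite [RHS]malgM_def fgmulgU mul_malgC malgZ_def; apply: eq_bigr => m _.
by rewrite mulm1 mulrC.
Qed.

Lemma pscaleAr c (x y : presAlg) : c *: (x * y) = x * (c *: y).
Proof.
elim/presW: x => x; elim/presW: y => y.
by rewrite /GRing.mul /GRing.scale /= !(pi_scaleE, pi_mulE) free_scalerAr.
Qed.

HB.instance Definition _ := GRing.Lalgebra_isAlgebra.Build k presAlg pscaleAr.

Definition pgen (x : pgens P) : presAlg := \pi_presAlg (fgen k x).

Fact pi_is_zmod_morphism : zmod_morphism (\pi_presAlg : free -> presAlg).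
Proof.
by move=> x y; rewrite /GRing.opp /GRing.add /= pi_oppE pi_addE.
Qed.

Fact pi_is_monoid_morphism : monoid_morphism (\pi_presAlg : free -> presAlg).
Proof. by split=> [|x y] //; rewrite [in RHS]/GRing.mul /= pi_mulE. Qed.

Fact pi_is_scalable : scalable (\pi_presAlg : free -> presAlg).
Proof. by move=> c x; rewrite [in RHS]/GRing.scale /= pi_scaleE. Qed.

Lemma feval_pgen (x : free) : feval pgen x = \pi_presAlg x.
Proof.
pose p : free -> presAlg := \pi_presAlg.
have pB : zmod_morphism p := pi_is_zmod_morphism.
have p0 : p 0 = 0 by [].
have pD a b : p (a + b) = p a + p b by rewrite /GRing.add /= pi_addE.
have [p1 pM] : monoid_morphism p := pi_is_monoid_morphism.
have pS : scalable p := pi_is_scalable.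
rewrite -/(p x) /feval /mmap [in RHS](monalgE x) (big_morph p pD p0).
apply: eq_bigr => m _; rewrite /= mulr_algl -[in RHS](mulr1 x@_m).
rewrite -[X in p X]/(mkmalgU m (x@_m * 1)).
have -> : << x@_m * 1 *g m >> = x@_m *: << m >> :> free.
  by apply/malgP => j; rewrite mcoeffZ !mcoeffU mulrnAr.
rewrite pS; congr (_ *: _).
case: m => m; rewrite /fmon_eval /=.
elim: m => [|y m IH]; first by rewrite big_nil -p1 -fmoneE.
rewrite big_cons IH.
have -> : << FMonom (y :: m) >> = fgen k y * << FMonom m >> :> free.
  by rewrite /fgen malgM_def fgmulUg msuppU oner_eq0 finmap.big_seq_fset1;
     rewrite mcoeffUU mulr1; congr (<< _ >>); apply/eqP;
     rewrite fmP fmM fmU.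
by rewrite pM.
Qed.

Lemma pgen_rel l r : @prel k P l r -> feval pgen l = feval pgen r.
Proof. by move=> h; rewrite !feval_pgen; apply/pi_eqP; exact: ideal_gen_rel. Qed.

Section Lift.
Variables (A : algType k) (f : pgens P -> A).
Hypothesis frel : forall l r, @prel k P l r -> feval f l = feval f r.

Definition plift (x : presAlg) : A := feval f (repr x).

Lemma plift_pi (x : free) : plift (\pi_presAlg x) = feval f x.
Proof.
apply/eqP; rewrite -subr_eq0 -rmorphB; apply/eqP.
by apply: (feval_ideal frel); exact: reprP.
Qed.

Fact plift_is_zmod_morphism : zmod_morphism plift.
Proof.
elim/presW=> x; elim/presW=> y.
by rewrite -pi_is_zmod_morphism !plift_pi rmorphB.
Qed.

Fact plift_is_monoid_morphism : monoid_morphism plift.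
Proof.
split; first by rewrite -[1 in LHS]/(\pi_presAlg 1) plift_pi rmorph1.
elim/presW=> x; elim/presW=> y.
by rewrite -(pi_is_monoid_morphism.2) !plift_pi rmorphM.
Qed.

Fact plift_is_scalable : scalable plift.
Proof.
by move=> c; elim/presW=> x; rewrite -pi_is_scalable !plift_pi linearZ.
Qed.

End Lift.

Theorem presAlg_universal (A : algType k) (f : pgens P -> A) :
  (forall l r, @prel k P l r -> feval f l = feval f r) ->
  exists2 phi : {lrmorphism presAlg -> A},
    forall x, phi (pgen x) = f x &
    forall psi : {lrmorphism presAlg -> A},
      (forall x, psi (pgen x) = f x) -> psi =1 phi.
Proof.
move=> frel.
pose z := GRing.isZmodMorphism.Build _ _ _ (plift_is_zmod_morphism frel).
pose m := GRing.isMonoidMorphism.Build _ _ _ (plift_is_monoid_morphism frel).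
pose c := GRing.isScalable.Build _ _ _ _ _ (plift_is_scalable frel).
pose phi : {lrmorphism presAlg -> A} := HB.pack (plift f) z m c.
exists phi => [x|psi hpsi].
  by rewrite -[LHS]/(plift f (\pi_presAlg (fgen k x))) plift_pi // feval_gen.
elim/presW=> x; rewrite -[RHS]/(plift f (\pi_presAlg x)) plift_pi //.
rewrite -feval_pgen /feval /mmap rmorph_sum; apply: eq_bigr => w _.
rewrite rmorphM /= rmorph_alg; congr (_ * _).
by rewrite rmorph_prod; apply: eq_bigr => y _; exact: hpsi.
Qed.

End PresentedAlgebra.

(* The gKi i stand for the inverses of the gK i. *)
Inductive qgen (I : Type) : Type :=
| gE of I | gF of I | gK of I | gKi of I.

Section QgenChoice.
Variable I : choiceType.

Definition qgen_enc (g : qgen I) : (I + I) + (I + I) :=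
  match g with
  | gE i => inl (inl i) | gF i => inl (inr i)
  | gK i => inr (inl i) | gKi i => inr (inr i)
  end.

Definition qgen_dec (s : (I + I) + (I + I)) : qgen I :=
  match s with
  | inl (inl i) => gE i | inl (inr i) => gF i
  | inr (inl i) => gK i | inr (inr i) => gKi i
  end.

Lemma qgen_encK : cancel qgen_enc qgen_dec.
Proof. by case. Qed.

HB.instance Definition _ := Choice.copy (qgen I) (can_type qgen_encK).

End QgenChoice.

Section QuantumNumbers.
Variables (k : fieldType) (A : lalgType k).

Definition qint (v : k) (m : nat) : k := (v ^+ m - v ^- m) / (v - v^-1).

Definition qfact (v : k) (m : nat) : k := \prod_(1 <= s < m.+1) qint v s.

Definition divpow (v : k) (x : A) (m : nat) : A := (qfact v m)^-1 *: x ^+ m.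

End QuantumNumbers.

Section KLambda.
Variables (A : nzRingType) (I : finType) (K Ki : I -> A).

(* The product of the K_i ^ m_i, where Ki i plays the role of K_i^-1. *)
Definition Kprod (lam : {ffun I -> int}) : A :=
  \prod_i match lam i with
          | Posz m => K i ^+ m
          | Negz m => Ki i ^+ m.+1
          end.

End KLambda.

Section A22.
Variables (k : fieldType) (q : k).
Local Notation free := (freeAlg k (qgen 'I_2)).

Local Notation E0 := (fgen k (gE (ord0 : 'I_2))).
Local Notation E1 := (fgen k (gE ord_max)).
Local Notation F0 := (fgen k (gF ord0)).
Local Notation F1 := (fgen k (gF ord_max)).
Local Notation K0 := (fgen k (gK ord0)).
Local Notation K1 := (fgen k (gK ord_max)).
Local Notation K0i := (fgen k (gKi ord0)).
Local Notation K1i := (fgen k (gKi ord_max)).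

(* The vertices 0 and 1 are ord0 and ord_max in 'I_2. *)
Inductive A22_rel : free -> free -> Prop :=
| A22_K0K0i : A22_rel (K0 * K0i) 1
| A22_K0iK0 : A22_rel (K0i * K0) 1
| A22_K1K1i : A22_rel (K1 * K1i) 1
| A22_K1iK1 : A22_rel (K1i * K1) 1
| A22_K0K1 : A22_rel (K0 * K1) (K1 * K0)
| A22_K1E1 : A22_rel (K1 * E1) (q ^+ 2 *: (E1 * K1))
| A22_K1E0 : A22_rel (K1 * E0) (q ^- 4 *: (E0 * K1))
| A22_K0E1 : A22_rel (K0 * E1) (q ^- 4 *: (E1 * K0))
| A22_K0E0 : A22_rel (K0 * E0) (q ^+ 8 *: (E0 * K0))
| A22_K1F1 : A22_rel (K1 * F1) (q ^- 2 *: (F1 * K1))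
| A22_K1F0 : A22_rel (K1 * F0) (q ^+ 4 *: (F0 * K1))
| A22_K0F1 : A22_rel (K0 * F1) (q ^+ 4 *: (F1 * K0))
| A22_K0F0 : A22_rel (K0 * F0) (q ^- 8 *: (F0 * K0))
| A22_E1F1 : A22_rel (E1 * F1 - F1 * E1) ((q - q^-1)^-1 *: (K1 - K1i))
| A22_E0F0 : A22_rel (E0 * F0 - F0 * E0) ((q ^+ 4 - q ^- 4)^-1 *: (K0 - K0i))
| A22_E1F0 : A22_rel (E1 * F0 - F0 * E1) 0
| A22_E0F1 : A22_rel (E0 * F1 - F1 * E0) 0
| A22_serreE01 :
    A22_rel (\sum_(r < 3) (-1) ^+ r *
               (divpow (q ^+ 4) E0 r * E1 * divpow (q ^+ 4) E0 (2 - r))) 0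
| A22_serreE10 :
    A22_rel (\sum_(r < 6) (-1) ^+ r *
               (divpow q E1 r * E0 * divpow q E1 (5 - r))) 0
| A22_serreF01 :
    A22_rel (\sum_(r < 3) (-1) ^+ r *
               (divpow (q ^+ 4) F0 r * F1 * divpow (q ^+ 4) F0 (2 - r))) 0
| A22_serreF10 :
    A22_rel (\sum_(r < 6) (-1) ^+ r *
               (divpow q F1 r * F0 * divpow q F1 (5 - r))) 0.

End A22.

Section Counit.
Variables (k : fieldType) (I : choiceType).

Definition counit_gen (g : qgen I) : k^o :=
  match g with gE _ | gF _ => 0 | gK _ | gKi _ => 1 end.

Local Notation free := (freeAlg k (qgen I)).

Definition counit : free -> k^o := feval counit_gen.

Lemma counitM x y : counit (x * y) = counit x * counit y.
Proof. exact: rmorphM. Qed.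
Lemma counitB x y : counit (x - y) = counit x - counit y.
Proof. exact: rmorphB. Qed.
Lemma counitZ c x : counit (c *: x) = c *: counit x.
Proof. exact: linearZZ. Qed.
Lemma counit0 : counit 0 = 0.
Proof. exact: rmorph0. Qed.
Lemma counit1 : counit 1 = 1.
Proof. exact: rmorph1. Qed.
Lemma counitG g : counit (fgen k g) = counit_gen g.
Proof. exact: feval_gen. Qed.

Lemma counit_serre m (f g : nat -> free) x : counit x = 0 ->
  counit (\sum_(r < m) (-1) ^+ r * (f r * x * g r)) = 0.
Proof.
move=> x0; rewrite /counit /feval rmorph_sum big1 // => r _.
suff: counit ((-1) ^+ r * (f r * x * g r)) = 0 by [].
by rewrite !counitM x0 mulr0 mul0r mulr0.
Qed.

Lemma proper_counit (rel : free -> free -> Prop) :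
  (forall l r, rel l r -> counit l = counit r) -> ~ ideal_gen rel 1.
Proof.
by move=> h /(feval_ideal h); rewrite rmorph1; apply/eqP; exact: oner_neq0.
Qed.

End Counit.

Lemma A22_proper (k : fieldType) (q : k) : ~ ideal_gen (A22_rel q) 1.
Proof.
apply: proper_counit => l r; case.
all: move: (@fgen k (qgen 'I_2)) (@counitG k 'I_2) => G evg.
18: by rewrite counit0 (counit_serre _ (fun r => divpow _ _ r)
         (fun r => divpow _ _ (2 - r))) // evg.
18: by rewrite counit0 (counit_serre _ (fun r => divpow _ _ r)
         (fun r => divpow _ _ (5 - r))) // evg.
18: by rewrite counit0 (counit_serre _ (fun r => divpow _ _ r)
         (fun r => divpow _ _ (2 - r))) // evg.
18: by rewrite counit0 (counit_serre _ (fun r => divpow _ _ r)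
         (fun r => divpow _ _ (5 - r))) // evg.
1-4: by rewrite counitM counit1 !evg /= mulr1.
1: by rewrite [LHS]counitM [RHS]counitM !evg.
1-8: by rewrite counitZ [LHS]counitM [X in _ *: X]counitM !evg /= mulr0 mul0r scaler0.
1-2: rewrite counitZ [LHS]counitB [X in X - _ = _]counitM [X in _ - X = _]counitM.
1-2: by rewrite [X in _ = _ *: X]counitB !evg /= mulr0 !subrr scaler0.
1-2: rewrite counit0 [LHS]counitB [X in X - _ = _]counitM [X in _ - X = _]counitM.
1-2: by rewrite !evg /= mulr0 subrr.
Qed.

Definition A22_pres (k : fieldType) (q : k) : presentation k :=
  Presentation (@A22_proper k q).

Definition UqA22 (k : fieldType) (q : k) : algType k := presAlg (A22_pres q).

(* The diagram is the path 1 - 2 - ... - n - 0, with vertex i encoded as the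
   element of 'I_n.+1 of value i; this makes sense for 1 <= n. *)
Section CartanDatum.
Variable n : nat.
Local Notation I := 'I_n.+1.

Definition dd (i : I) : nat :=
  if i == 0%N :> nat then 4 else if i == 1%N :> nat then 1 else 2.

Definition adj (i j : I) : bool :=
  [|| [&& 0 < i & j == i.+1 :> nat], [&& 0 < j & i == j.+1 :> nat],
      [&& i == n :> nat & j == 0 :> nat] | [&& j == n :> nat & i == 0 :> nat]]%N.

Definition cartan (i j : I) : int :=
  if i == j then 2
  else if adj i j then - (maxn (dd i) (dd j) %/ dd i)%N%:Z else 0.

Lemma dd_cartan i j : i != j -> adj i j ->
  (dd i)%:Z * cartan i j = - (maxn (dd i) (dd j))%:Z.
Proof.
move=> ij hij; rewrite /cartan (negbTE ij) hij mulrN -PoszM mulnC divnK //.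
by rewrite /dd; do 4?case: ifP.
Qed.

Definition rootLattice := {ffun I -> int}.

Definition alpha (i : I) : rootLattice := [ffun j => (i == j)%:Z].

Definition delta : rootLattice := [ffun j => if j == ord0 then 1 else 2].

Definition form (lam mu : rootLattice) : int :=
  \sum_i \sum_j lam i * mu j * ((dd i)%:Z * cartan i j).

Definition refl (i : I) (lam : rootLattice) : rootLattice :=
  lam - alpha i *~ (\sum_j lam j * cartan i j).

Lemma refl_alpha i j : refl i (alpha j) = alpha j - alpha i *~ cartan i j.
Proof.
rewrite /refl (bigD1 j) //= !ffunE eqxx mul1r big1 ?addr0 // => l lj.
by rewrite ffunE eq_sym (negbTE lj) mul0r.
Qed.

Lemma form_alpha i j : form (alpha i) (alpha j) = (dd i)%:Z * cartan i j.
Proof.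
rewrite /form (bigD1 i) //= [X in _ + X]big1 => [|l li]; last first.
  by apply: big1 => m _; rewrite ffunE eq_sym (negbTE li) !mul0r.
rewrite addr0 (bigD1 j) //= !ffunE !eqxx !mul1r big1 ?addr0 // => l lj.
by rewrite !ffunE [j == l]eq_sym (negbTE lj) mulr0 mul0r.
Qed.

End CartanDatum.

Section A2n2.
Variables (k : fieldType) (q : k) (n : nat).
Local Notation I := 'I_n.+1.

Definition qq (i : I) : k := q ^+ dd i.

Section Relations.
Local Notation free := (freeAlg k (qgen I)).

Local Notation E i := (fgen k (gE i)).
Local Notation F i := (fgen k (gF i)).
Local Notation K i := (fgen k (gK i)).
Local Notation Ki i := (fgen k (gKi i)).

Definition freeKl (lam : rootLattice n) : free :=
  Kprod (fun i => K i) (fun i => Ki i) lam.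

Definition serre (x y : free) (i j : I) : free :=
  let m := absz (1 - cartan i j) in
  \sum_(r < m.+1) (-1) ^+ r * (divpow (qq i) x r * y * divpow (qq i) x (m - r)).

(* The generator D of the full algebra is left out. *)
Inductive A2n2_rel : free -> free -> Prop :=
| A2n2_KKi i : A2n2_rel (K i * Ki i) 1
| A2n2_KiK i : A2n2_rel (Ki i * K i) 1
| A2n2_KK i j : A2n2_rel (K i * K j) (K j * K i)
| A2n2_KE lam i :
    A2n2_rel (freeKl lam * E i) (q ^ form lam (alpha i) *: (E i * freeKl lam))
| A2n2_KF lam i :
    A2n2_rel (freeKl lam * F i) (q ^ (- form lam (alpha i)) *: (F i * freeKl lam))
| A2n2_EF i j :
    A2n2_rel (E i * F j - F j * E i)
      (if i == j then (qq i - (qq i)^-1)^-1 *: (K i - Ki i) else 0)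
| A2n2_serreE i j : i != j -> A2n2_rel (serre (E i) (E j) i j) 0
| A2n2_serreF i j : i != j -> A2n2_rel (serre (F i) (F j) i j) 0.

Lemma A2n2_proper : ~ ideal_gen A2n2_rel 1.
Proof.
apply: proper_counit => l r; case.
- by move=> i; rewrite counitM counit1 !counitG /= mulr1.
- by move=> i; rewrite counitM counit1 !counitG /= mulr1.
- by move=> i j; rewrite [LHS]counitM [RHS]counitM !counitG.
- move=> lam i; rewrite counitZ [LHS]counitM [X in _ *: X]counitM counitG /=.
  by rewrite mulr0 mul0r scaler0.
- move=> lam i; rewrite counitZ [LHS]counitM [X in _ *: X]counitM counitG /=.
  by rewrite mulr0 mul0r scaler0.
- move=> i j; rewrite [LHS]counitB [X in X - _ = _]counitM.
  rewrite [X in _ - X = _]counitM !counitG /= mulr0 subrr.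
  case: eqP => _; last by rewrite counit0.
  by rewrite counitZ counitB !counitG subrr scaler0.
- move=> i j _; rewrite counit0 /serre; set m := absz _.
  apply: (counit_serre m.+1 (fun r => divpow (qq i) (E i) r)
            (fun r => divpow (qq i) (E i) (m - r))).
  by rewrite counitG.
- move=> i j _; rewrite counit0 /serre; set m := absz _.
  apply: (counit_serre m.+1 (fun r => divpow (qq i) (F i) r)
            (fun r => divpow (qq i) (F i) (m - r))).
  by rewrite counitG.
Qed.

End Relations.

Definition A2n2_pres : presentation k := Presentation A2n2_proper.

Definition UqA2n2 : algType k := presAlg A2n2_pres.

Definition UE (i : I) : UqA2n2 := @pgen k A2n2_pres (gE i).
Definition UF (i : I) : UqA2n2 := @pgen k A2n2_pres (gF i).
Definition UK (i : I) : UqA2n2 := @pgen k A2n2_pres (gK i).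
Definition UKi (i : I) : UqA2n2 := @pgen k A2n2_pres (gKi i).
Definition UKl (lam : rootLattice n) : UqA2n2 := Kprod UK UKi lam.

End A2n2.

Definition A22E (k : fieldType) (q : k) (i : 'I_2) : UqA22 q :=
  @pgen k (A22_pres q) (gE i).
Definition A22F (k : fieldType) (q : k) (i : 'I_2) : UqA22 q :=
  @pgen k (A22_pres q) (gF i).
Definition A22K (k : fieldType) (q : k) (i : 'I_2) : UqA22 q :=
  @pgen k (A22_pres q) (gK i).
Definition A22Ki (k : fieldType) (q : k) (i : 'I_2) : UqA22 q :=
  @pgen k (A22_pres q) (gKi i).

Definition Cq (R : realType) : fieldType := {fraction {poly R[i]}}.
Definition constq (R : realType) (c : R[i]) : Cq R := tofrac c%:P.
Definition qvar (R : realType) : Cq R := tofrac ('X : {poly R[i]}).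

Section BraidAction.
Variables (R : realType) (n : nat).
Local Notation q := (qvar R).
Local Notation I := 'I_n.+1.
Local Notation U := (UqA2n2 q n).

Record is_Omega (Om : U -> U) : Prop := IsOmega {
  Omega_add : forall x y, Om (x + y) = Om x + Om y;
  Omega_mul : forall x y, Om (x * y) = Om y * Om x;
  Omega_one : Om 1 = 1;
  (* these two say that Om is semilinear for the automorphism of C(q) that
     conjugates constants and inverts q *)
  Omega_const : forall (c : R[i]) x, Om (constq c *: x) = constq c^* *: Om x;
  Omega_q : forall x, Om (q *: x) = q^-1 *: Om x;
  Omega_inv : involutive Om;
  Omega_E : forall i, Om (UE q i) = UF q i;
  Omega_F : forall i, Om (UF q i) = UE q i;
  Omega_K : forall i, Om (UK q i) = UKi q i }.

(* T i (T j (T i ...)), with m factors *)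
Fixpoint alternate (T : I -> U -> U) (m : nat) (i j : I) (x : U) : U :=
  if m is m'.+1 then T i (alternate T m' j i x) else x.

(* The order of s_i s_j, for i != j; None when it is infinite. *)
Definition coxeter (i j : I) : option nat :=
  match absz (cartan i j * cartan j i)%R with
  | 0 => Some 2 | 1 => Some 3 | 2 => Some 4 | 3 => Some 6 | _ => None
  end%N.

(* T i and Tinv i are the two directions of one algebra automorphism. The values
   T i (F j) follow from braid_Omega. *)
Record is_braid_action (Om : U -> U) (T : I -> {lrmorphism U -> U})
    (Tinv : I -> U -> U) : Prop := IsBraidAction {
  braid_K : forall i, cancel (T i) (Tinv i);
  braid_Kinv : forall i, cancel (Tinv i) (T i);
  braid_rel : forall i j m, i != j -> coxeter i j = Some m ->
    forall x, alternate T m i j x = alternate T m j i x;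
  braid_Omega : forall i x, T i (Om x) = Om (T i x);
  braid_Kl : forall i lam, T i (UKl q lam) = UKl q (refl i lam);
  braid_Ei : forall i, T i (UE q i) = - (UF q i * UK q i);
  braid_Ej : forall i j, i != j ->
    let m := absz (cartan i j) in
    T i (UE q j) = \sum_(r < m.+1) ((-1) ^+ (r + m) * qq q i ^- r) *:
      (divpow (qq q i) (UE q i) (m - r) * UE q j * divpow (qq q i) (UE q i) r) }.

Section RootVectors.
Variables (Om : U -> U) (T : I -> {lrmorphism U -> U}) (Tinv : I -> U -> U).

Definition vtx1 : I := inord 1.

(* T_0 T_n T_(n-1) ... T_1 *)
Definition Tw (x : U) : U :=
  foldr (fun (j : nat) y => T (inord j) y) x (0%N :: rev (iota 1 n)).

Definition Tomega1 (x : U) : U := iter n Tw x.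

Definition E_delta_2alpha1 : U := iter n.-1 Tw (UE q ord0).
Definition E_delta_alpha1 : U := Tomega1 (Tinv vtx1 (UE q vtx1)).
Definition F_delta_2alpha1 : U := Om E_delta_2alpha1.
Definition F_delta_alpha1 : U := Om E_delta_alpha1.

Inductive Uq1_gen : U -> Prop :=
| Uq1_E1 : Uq1_gen (UE q vtx1)
| Uq1_Ed : Uq1_gen E_delta_alpha1
| Uq1_F1 : Uq1_gen (UF q vtx1)
| Uq1_Fd : Uq1_gen F_delta_alpha1
| Uq1_K1 : Uq1_gen (UK q vtx1)
| Uq1_K1i : Uq1_gen (UKi q vtx1)
| Uq1_Kd : Uq1_gen (UKl q (delta n))
| Uq1_Kdi : Uq1_gen (UKl q (- delta n)).

End RootVectors.
End BraidAction.

Inductive subalg_gen (k : fieldType) (A : algType k) (S : A -> Prop) : A -> Prop :=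
| subalg_gen_in x : S x -> subalg_gen S x
| subalg_gen1 : subalg_gen S 1
| subalg_genD x y : subalg_gen S x -> subalg_gen S y -> subalg_gen S (x + y)
| subalg_genZ c x : subalg_gen S x -> subalg_gen S (c *: x)
| subalg_genM x y : subalg_gen S x -> subalg_gen S y -> subalg_gen S (x * y).

Definition Uq1 (R : realType) (n : nat) (Om : UqA2n2 (qvar R) n -> UqA2n2 (qvar R) n)
    (T : 'I_n.+1 -> {lrmorphism UqA2n2 (qvar R) n -> UqA2n2 (qvar R) n})
    (Tinv : 'I_n.+1 -> UqA2n2 (qvar R) n -> UqA2n2 (qvar R) n) :
    UqA2n2 (qvar R) n -> Prop :=
  subalg_gen (Uq1_gen Om T Tinv).

(* Main.v *)
(* Put c = T_0 T_n ... T_1 and X = T_n ... T_2 (E_1). The Coxeter element c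
   shifts the middle braid generators, c T_(j+1) = T_j c, which together with
   the rank two identities T_n T_0 T_n (E_0) = E_0 and T_2 T_1 T_2 (E_1) = E_1
   gives E_(delta-2alpha_1) = T_2^-1 ... T_n^-1 (E_0) and c^(n-1) (X) = E_1.
   Hence E_(delta-2alpha_1) is a combination of words with two letters E_2 and
   all other letters among E_0, E_3, ..., E_n. It therefore commutes with F_1,
   and, since q-commutation by E_1 is a skew derivation which kills those other
   letters and whose cube kills E_2, its fifth power kills E_(delta-2alpha_1):
   this is one Serre relation. The other one is transported by c^(n-1) from the
   pair (E_0, X), X being linear in E_n with all other letters commuting with
   E_0. The relations on the F side follow by Omega. Finally c^(n-1) applied to
   T_0 (X) shows that E_(delta-alpha_1) is a q-commutator of E_(delta-2alpha_1)
   and E_1, so that its commutator with F_1 is a multiple of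
   E_(delta-2alpha_1) K_1. *)

Require Import Defs.
From mathcomp Require Import all_boot all_order all_algebra.
From mathcomp Require Import reals complex monalg.
From mathcomp Require Import ring zify.

Set Implicit Arguments.
Unset Strict Implicit.
Unset Printing Implicit Defensive.

Import GRing.Theory.
Local Open Scope ring_scope.

(** * Noncommutative normal forms *)

(** No single description of E_(delta-2alpha_1) makes all relations easy. As c^(n-1)(E_0) it
    inherits whatever concerns E_0, F_0, K_0 alone, but how E_1 and F_1 meet it is visible only on
    words. Serre sums are replaced by powers of x -> E x - (K x K^-1) E: if K x K^-1 = v^-m x, its
    power m+1 sends x to the Serre sum of order m+1, up to a nonzero scalar. The order 5 is then a
    count: two letters E_2, each of weight q^-2 for K_1, give weight q^-4 and order 2 * 2 + 1. For n
    = 1 the power of c is trivial, E_(delta-2alpha_1) is E_0, and a_10 = -4 gives the same weight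
    and order; hence the case splits. The rank two identities are instances of T_w(E_i) = E_j for w
    alpha_i = alpha_j. At the double bonds they are checked by expanding into words, which is the
    purpose of the normal form tactic. *)

Inductive ncexp (k : Type) : Type :=
| NcVar of nat | NcZero | NcOne | NcAdd of ncexp k & ncexp k
| NcOpp of ncexp k | NcMul of ncexp k & ncexp k | NcScale of k & ncexp k.

Section NcNormalForm.
Variables (k : fieldType) (A : algType k) (env : seq A).

Definition ncpoly := seq (k * seq nat).
Definition ncrules := seq (seq nat * ncpoly).

Fixpoint nceval (e : ncexp k) : A :=
  match e with
  | NcVar i => nth 0 env i | NcZero => 0 | NcOne => 1
  | NcAdd a b => nceval a + nceval b | NcOpp a => - nceval a
  | NcMul a b => nceval a * nceval b | NcScale c a => c *: nceval a
  end.

Fixpoint weval (w : seq nat) : A :=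
  if w is i :: w' then nth 0 env i * weval w' else 1.
Fixpoint peval (p : ncpoly) : A :=
  if p is cw :: p' then cw.1 *: weval cw.2 + peval p' else 0.

(** A private copy of append: [nc] evaluates by [cbv] on a fixed list of constants, so words compute
    while the coefficients in [k] stay as they are. [PeanoNat.Nat.eqb] is used for the same
    reason. *)
Fixpoint nccat T (s t : seq T) : seq T := if s is x :: s' then x :: nccat s' t else t.

(* multiplication by c on the left, and by the words u and w on both sides *)
Fixpoint ncscale (c : k) (u : seq nat) (p : ncpoly) (w : seq nat) : ncpoly :=
  if p is dv :: p' then
    (c * dv.1, nccat u (nccat dv.2 w)) :: ncscale c u p' w
  else [::].

Fixpoint ncmul (p r : ncpoly) : ncpoly :=
  if p is cw :: p' then nccat (ncscale cw.1 cw.2 r [::]) (ncmul p' r) else [::].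

Fixpoint ncwords (e : ncexp k) : ncpoly :=
  match e with
  | NcVar i => [:: (1, [:: i])] | NcZero => [::] | NcOne => [:: (1, [::])]
  | NcAdd a b => nccat (ncwords a) (ncwords b)
  | NcOpp a => ncscale (-1) [::] (ncwords a) [::]
  | NcMul a b => ncmul (ncwords a) (ncwords b)
  | NcScale c a => ncscale c [::] (ncwords a) [::]
  end.

Fixpoint ncprefix (w u : seq nat) : option (seq nat) :=
  match w, u with
  | [::], _ => Some u
  | i :: w', j :: u' => if PeanoNat.Nat.eqb i j then ncprefix w' u' else None
  | _, _ => None
  end.

Fixpoint nchead (R : ncrules) (u : seq nat) : option ncpoly :=
  if R is (w, p) :: R' then
    if ncprefix w u is Some v then Some (ncscale 1 [::] p v) else nchead R' u
  else None.

Fixpoint ncstep (R : ncrules) (u : seq nat) : option ncpoly :=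
  if nchead R u is Some p then Some p else
  if u is i :: u' then
    if ncstep R u' is Some p then Some (ncscale 1 [:: i] p [::]) else None
  else None.

Fixpoint ncpass (R : ncrules) (p : ncpoly) : ncpoly :=
  if p is cw :: p' then
    nccat (if ncstep R cw.2 is Some r then ncscale cw.1 [::] r [::] else [:: cw])
      (ncpass R p')
  else [::].

Fixpoint nceqw (u w : seq nat) : bool :=
  match u, w with
  | [::], [::] => true
  | i :: u', j :: w' => if PeanoNat.Nat.eqb i j then nceqw u' w' else false
  | _, _ => false
  end.

Fixpoint ncinsert (cw : k * seq nat) (p : ncpoly) : ncpoly :=
  if p is dv :: p' then
    if nceqw cw.2 dv.2 then (cw.1 + dv.1, dv.2) :: p' else dv :: ncinsert cw p'
  else [:: cw].

Fixpoint nccollect (p : ncpoly) : ncpoly :=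
  if p is cw :: p' then ncinsert cw (nccollect p') else [::].

(** Fuel replaces termination: every round preserves the value, so neither termination nor
    confluence of the rules has to be shown. *)
Fixpoint ncnorm (fuel : nat) (R : ncrules) (p : ncpoly) : ncpoly :=
  if fuel is m.+1 then ncnorm m R (nccollect (ncpass R p)) else p.

Fixpoint ncvanish (p : ncpoly) : Prop :=
  if p is cw :: p' then cw.1 = 0 /\ ncvanish p' else True.

(** Nested to the left and without a final 1, as [a * b * c] is parsed, so that the equations handed
    to [nc] prove [ncvalid] up to conversion. *)
Definition ncword (w : seq nat) : A :=
  if w is i :: w' then foldl (fun x j => x * nth 0 env j) (nth 0 env i) w' else 1.

Fixpoint ncvalid (R : seq (seq nat * ncexp k)) : Prop :=
  if R is we :: R' then ncword we.1 = nceval we.2 /\ ncvalid R' else True.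

Fixpoint ncrule (R : seq (seq nat * ncexp k)) : ncrules :=
  if R is we :: R' then (we.1, ncwords we.2) :: ncrule R' else [::].

Lemma nccatE T (s t : seq T) : nccat s t = s ++ t.
Proof. by elim: s => //= x s ->. Qed.

Lemma weval_cat u w : weval (u ++ w) = weval u * weval w.
Proof. by elim: u => [|i u IH] /=; rewrite ?mul1r // IH mulrA. Qed.

Lemma peval_cat p r : peval (p ++ r) = peval p + peval r.
Proof. by elim: p => [|cw p IH] /=; rewrite ?add0r // IH addrA. Qed.

Lemma peval_scale c u p w :
  peval (ncscale c u p w) = c *: (weval u * peval p * weval w).
Proof.
elim: p => [|[d v] p IH] /=; first by rewrite mulr0 mul0r scaler0.
rewrite IH !nccatE !weval_cat mulrDr mulrDl scalerDr; congr (_ + _).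
by rewrite -scalerAr -scalerAl scalerA mulrA.
Qed.

Lemma peval_mul p r : peval (ncmul p r) = peval p * peval r.
Proof.
elim: p => [|[c w] p IH] /=; first by rewrite mul0r.
by rewrite nccatE peval_cat IH peval_scale mulr1 mulrDl scalerAl.
Qed.

Lemma ncwordsE e : peval (ncwords e) = nceval e.
Proof.
elim: e => /= [i|||a IHa b IHb|a IHa|a IHa b IHb|c a IHa] //.
- by rewrite mulr1 scale1r addr0.
- by rewrite scale1r addr0.
- by rewrite nccatE peval_cat IHa IHb.
- by rewrite peval_scale mul1r mulr1 IHa scaleN1r.
- by rewrite peval_mul IHa IHb.
- by rewrite peval_scale mul1r mulr1 IHa.
Qed.

Lemma eqbE i j : PeanoNat.Nat.eqb i j = (i == j).
Proof. by apply/idP/eqP => /PeanoNat.Nat.eqb_eq. Qed.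

Lemma ncprefixE w u v : ncprefix w u = Some v -> u = w ++ v.
Proof.
elim: w u => [|i w IH] [|j u] //=; try by case=> ->.
by rewrite eqbE; case: eqP => // -> /IH ->.
Qed.

Lemma nceqwE u w : nceqw u w -> u = w.
Proof.
elim: u w => [|i u IH] [|j w] //=; rewrite eqbE.
by case: eqP => // -> /IH ->.
Qed.

Section Rules.
Variable R : ncrules.
Hypothesis hR : forall w p, (w, p) \in R -> weval w = peval p.

Lemma ncheadE u p : nchead R u = Some p -> peval p = weval u.
Proof.
elim: R hR => //= -[w r] R' IH hR'.
case h: (ncprefix w u) => [v|]; last first.
  by apply: IH => w' p' h'; apply: hR'; rewrite inE h' orbT.
case=> <-; rewrite (ncprefixE h) peval_scale scale1r mul1r weval_cat.
by rewrite (hR' w r) // inE eqxx.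
Qed.

Lemma ncstepE u p : ncstep R u = Some p -> peval p = weval u.
Proof.
elim: u p => [|i u IH] p /=.
  by case h: (nchead R [::]) => [r|] // [<-]; rewrite (ncheadE h).
case h: (nchead R (i :: u)) => [r|]; first by case=> <-; rewrite (ncheadE h).
case h': (ncstep R u) => [r|] // [<-].
by rewrite peval_scale scale1r /= !mulr1 (IH r).
Qed.

Lemma ncpassE p : peval (ncpass R p) = peval p.
Proof.
elim: p => //= -[c w] p IH; rewrite nccatE peval_cat IH; congr (_ + _).
case h: (ncstep R w) => [r|] /=; last by rewrite addr0.
by rewrite peval_scale mul1r mulr1 (ncstepE h).
Qed.

Lemma nccollectE p : peval (nccollect p) = peval p.
Proof.
elim: p => //= -[c w] p <-; elim: (nccollect p) => //= -[d v] r IH.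
case: ifP => /= [/nceqwE ->|_]; first by rewrite scalerDl addrA.
by rewrite IH addrCA.
Qed.

Lemma ncnormE m p : peval (ncnorm m R p) = peval p.
Proof. by elim: m p => //= m IH p; rewrite IH nccollectE ncpassE. Qed.

End Rules.

Lemma ncwordE w : ncword w = weval w.
Proof.
case: w => //= i w; elim: w (nth 0 env i) => [|j w IH] x /=; first by rewrite mulr1.
by rewrite IH mulrA.
Qed.

Lemma nc_sound m R e1 e2 : ncvalid R ->
  ncvanish (ncnorm m (ncrule R) (ncwords (NcAdd e1 (NcOpp e2)))) ->
  nceval e1 = nceval e2.
Proof.
move=> hR h; apply/eqP; rewrite -subr_eq0; apply/eqP.
rewrite -[LHS]/(nceval (NcAdd e1 (NcOpp e2))) -ncwordsE -(@ncnormE (ncrule R) _ m).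
  by elim: (ncnorm _ _ _) h => //= -[c w] p IH [-> /IH ->]; rewrite scale0r addr0.
elim: R hR {h} => //= -[u e] R IH [ue /IH hR] w p.
rewrite inE => /orP[/eqP[-> ->]|]; last exact: hR.
by rewrite ncwordsE -[RHS]ue ncwordE.
Qed.

End NcNormalForm.

Ltac nc_mem x env :=
  lazymatch env with
  | @nil _ => constr:(false)
  | @cons _ x _ => constr:(true)
  | @cons _ _ ?t => nc_mem x t
  end.
Ltac nc_atom x env :=
  let b := nc_mem x env in
  lazymatch b with true => env | false => constr:(cons x env) end.
Ltac nc_atoms t env :=
  lazymatch t with
  | @GRing.zero _ => env
  | @GRing.one _ => env
  | GRing.add ?a ?b => let env := nc_atoms a env in nc_atoms b env
  | GRing.mul ?a ?b => let env := nc_atoms a env in nc_atoms b env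
  | GRing.opp ?a => nc_atoms a env
  | GRing.scale _ ?a => nc_atoms a env
  | _ => nc_atom t env
  end.
Ltac nc_index x env :=
  lazymatch env with
  | @cons _ x _ => constr:(O)
  | @cons _ _ ?t => let i := nc_index x t in constr:(S i)
  end.
Ltac nc_reify k t env :=
  lazymatch t with
  | @GRing.zero _ => constr:(@NcZero k)
  | @GRing.one _ => constr:(@NcOne k)
  | GRing.add ?a ?b =>
      let a := nc_reify k a env in let b := nc_reify k b env in
      constr:(@NcAdd k a b)
  | GRing.mul ?a ?b =>
      let a := nc_reify k a env in let b := nc_reify k b env in
      constr:(@NcMul k a b)
  | GRing.opp ?a => let a := nc_reify k a env in constr:(@NcOpp k a)
  | GRing.scale ?c ?a => let a := nc_reify k a env in constr:(@NcScale k c a)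
  | _ => let i := nc_index t env in constr:(@NcVar k i)
  end.
Ltac nc_word t env acc :=
  lazymatch t with
  | GRing.mul ?a ?b => let i := nc_index b env in nc_word a env (@cons nat i acc)
  | _ => let i := nc_index t env in constr:(@cons nat i acc)
  end.
Ltac nc_rule_atoms rs env :=
  lazymatch rs with
  | (?rs', ?r) => let env := nc_rule_atoms rs' env in nc_rule_atoms r env
  | ?r => lazymatch type of r with
          | ?a = ?b => let env := nc_atoms a env in nc_atoms b env
          | _ => env
          end
  end.
Ltac nc_rules k rs env acc :=
  lazymatch rs with
  | (?rs', ?r) => let acc := nc_rules k r env acc in nc_rules k rs' env acc
  | ?r => lazymatch type of r with
          | ?a = ?b => let w := nc_word a env (@nil nat) in
                       let e := nc_reify k b env in
                       constr:(@cons (seq nat * ncexp k) (w, e) acc)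
          | _ => acc
          end
  end.
Ltac nc_valid rs acc :=
  lazymatch rs with
  | (?rs', ?r) => let acc := nc_valid r acc in nc_valid rs' acc
  | ?r => lazymatch type of r with
          | _ = _ => uconstr:(conj r acc)
          | _ => acc
          end
  end.

(* [nc k A rules] proves an equation in the algebra A over k by expanding it
   into words in its atoms, rewriting these with the tuple [rules] of equations
   [word = expression], and comparing coefficients, which leaves an equation in
   k for each word. *)
Ltac nc k A rs :=
  lazymatch goal with
  | |- ?a = ?b =>
    let env := constr:(@nil A) in
    let env := nc_atoms a env in
    let env := nc_atoms b env in
    let env := nc_rule_atoms rs env in
    let a' := nc_reify k a env in
    let b' := nc_reify k b env in
    let R := nc_rules k rs env (@nil (seq nat * ncexp k)) in
    let V := nc_valid rs uconstr:(Logic.I) in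
    change (@nceval k A env a' = @nceval k A env b');
    apply: (@nc_sound k A env 20%nat R a' b'); [exact V|];
    cbv [ncvanish ncnorm ncrule ncwords ncmul ncscale nccat ncpass ncstep nchead
         ncprefix nccollect ncinsert nceqw PeanoNat.Nat.eqb fst snd];
    repeat (split; [|]); try exact Logic.I
  end.

(** * The q-adjoint action *)

Section QAdjoint.
Variables (k : fieldType) (A : algType k) (e K Ki : A).

Definition conjK (x : A) : A := K * x * Ki.
(** The left adjoint action of E for the comultiplication sending E to E ⊗ 1 + K ⊗ E. *)
Definition qad (x : A) : A := e * x - conjK x * e.

Lemma conjKD x y : conjK (x + y) = conjK x + conjK y.
Proof. by rewrite /conjK mulrDr mulrDl. Qed.

Lemma conjKZ c x : conjK (c *: x) = c *: conjK x.
Proof. by rewrite /conjK -scalerAr -scalerAl. Qed.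

Lemma qadD x y : qad (x + y) = qad x + qad y.
Proof. by rewrite /qad conjKD mulrDr mulrDl opprD addrACA. Qed.

Lemma qadZ c x : qad (c *: x) = c *: qad x.
Proof. by rewrite /qad conjKZ -scalerAr -scalerAl scalerBr. Qed.

Lemma qad0 : qad 0 = 0.
Proof. by have := qadZ 0 0; rewrite !scale0r. Qed.

Lemma iter_qadD m x y : iter m qad (x + y) = iter m qad x + iter m qad y.
Proof. by elim: m => //= m ->; rewrite qadD. Qed.

Lemma iter_qadZ m c x : iter m qad (c *: x) = c *: iter m qad x.
Proof. by elim: m => //= m ->; rewrite qadZ. Qed.

Lemma iter_qad0 m : iter m qad 0 = 0.
Proof. by elim: m => //= m ->; rewrite qad0. Qed.

Hypotheses (KKi : K * Ki = 1) (KiK : Ki * K = 1).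

Lemma conjKM x y : conjK (x * y) = conjK x * conjK y.
Proof. by rewrite /conjK !mulrA -(mulrA (K * x) Ki K) KiK mulr1. Qed.

Lemma conjK_scale c x : K * x = c *: (x * K) -> conjK x = c *: x.
Proof. by move=> h; rewrite /conjK h -scalerAl -mulrA KKi mulr1. Qed.

Lemma conjK_scaleV c x : conjK x = c *: x -> K * x = c *: (x * K).
Proof. by move=> h; rewrite scalerAl -h /conjK -(mulrA _ Ki K) KiK mulr1. Qed.

Lemma qadM x y : qad (x * y) = qad x * y + conjK x * qad y.
Proof.
rewrite /qad conjKM mulrBl mulrBr !mulrA addrA; congr (_ - _).
by rewrite subrK.
Qed.

Lemma qad_comm_mull x y : conjK x = x -> qad x = 0 -> qad (x * y) = x * qad y.
Proof. by move=> hx x0; rewrite qadM x0 mul0r add0r hx. Qed.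

Lemma qad_comm_mulr x y : qad y = 0 -> qad (x * y) = qad x * y.
Proof. by move=> y0; rewrite qadM y0 mulr0 addr0. Qed.

Variable v : k.
Hypotheses (v0 : v != 0) (Ke : K * e = v ^+ 2 *: (e * K)).

Lemma conjK_qad x : conjK (qad x) = v ^+ 2 *: qad (conjK x).
Proof.
rewrite /qad -scaleN1r conjKD conjKZ !conjKM (conjK_scale Ke) scaleN1r.
by rewrite -scalerAl -scalerAr scalerBr.
Qed.

Lemma conjK_iter_qad m x :
  conjK (iter m qad x) = v ^+ (m.*2) *: iter m qad (conjK x).
Proof.
elim: m x => [|m IH] x /=; first by rewrite scale1r.
by rewrite conjK_qad IH qadZ scalerA -exprD.
Qed.

(* The qad-nilpotent elements form a filtered algebra, since qad is a skew
   derivation whose twist preserves the kernels of the powers of qad. *)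
Lemma iter_qadM a b x y : iter a qad x = 0 -> iter b qad y = 0 ->
  iter (a + b).-1 qad (x * y) = 0.
Proof.
have [s] := ubnP (a + b); elim: s a b x y => // s IH [|a] [|b] x y hs.
- by move=> /= -> _; rewrite mul0r.
- by move=> /= -> _; rewrite mul0r iter_qad0.
- by move=> _ /= ->; rewrite mulr0 iter_qad0.
move=> hx hy; rewrite addSn -pred_Sn addnS iterSr qadM iter_qadD.
have -> : iter (a + b) qad (qad x * y) = 0.
  have := IH a b.+1 (qad x) y; rewrite addnS -pred_Sn; apply => //.
    by move: hs; rewrite !addSn !addnS.
  by rewrite -iterSr.
have := IH a.+1 b (conjK x) (qad y); rewrite addSn -pred_Sn add0r; apply.
- by move: hs; rewrite !addSn !addnS.
(* Up to a power of [v], the iterate on [conjK x] is [conjK] of the iterate on [x], which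
   vanishes. *)
- apply: (scalerI (expf_neq0 (a.+1).*2 v0)).
  by rewrite -conjK_iter_qad hx scaler0 /conjK mulr0 mul0r.
- by rewrite -iterSr.
Qed.

Hypothesis vv : v - v^-1 != 0.

(** A form of the q-Pascal rule; it adds up the two contributions to one word in
    [iter_qad_divpow]. *)
Lemma qint_shift (j r : nat) : (r <= j)%N ->
  v ^- r * qint v (j - r) + v ^+ (j - r) * qint v r = qint v j.
Proof.
move=> rj; rewrite /qint !mulrA -mulrDl; congr (_ / _).
have -> : v ^+ j = v ^+ r * v ^+ (j - r) by rewrite -exprD subnKC.
have hr : v ^+ r != 0 by rewrite expf_neq0.
have hj : v ^+ (j - r) != 0 by rewrite expf_neq0.
by field; rewrite hr hj.
Qed.

Lemma qfactS m : qfact v m.+1 = qfact v m * qint v m.+1.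
Proof. by rewrite /qfact big_nat_recr. Qed.

Hypothesis qint_neq0 : forall m, (0 < m)%N -> qint v m != 0.

Lemma qfact_neq0 m : qfact v m != 0.
Proof.
elim: m => [|m IH]; first by rewrite /qfact big_geq // oner_neq0.
by rewrite qfactS mulf_neq0 // qint_neq0.
Qed.

Lemma divpow0 x : divpow v x 0 = 1 :> A.
Proof. by rewrite /divpow /qfact big_geq // invr1 scale1r expr0. Qed.

Lemma mul_divpow x m : x * divpow v x m = qint v m.+1 *: divpow v x m.+1 :> A.
Proof.
rewrite /divpow -scalerAr -exprS scalerA qfactS invfM mulrCA mulfV ?mulr1 //.
exact: qint_neq0.
Qed.

Lemma divpow_mul x m : divpow v x m * x = qint v m.+1 *: divpow v x m.+1 :> A.
Proof.
rewrite -mul_divpow /divpow -scalerAl -scalerAr; congr (_ *: _).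
by rewrite -exprSr -exprS.
Qed.

(** On a word with m letters [e] around [x] the twist is the scalar t v^(2m), so one more [qad] only
    lengthens the word by an [e] on its left or on its right. At m = 0 only r = 0 occurs, and [m.-1]
    is harmless. *)
Lemma iter_qad_divpow t x m : conjK x = t *: x ->
  iter m qad x = qfact v m *:
    \sum_(r < m.+1) ((-1) ^+ r * (t * v ^+ m.-1) ^+ r) *:
      (divpow v e (m - r) * x * divpow v e r).
Proof.
move=> hx; elim: m => [|m IH].
  by rewrite big_ord1 /= !expr0 mulr1 scale1r !divpow0 mulr1 mul1r /qfact
     big_geq // scale1r.
rewrite iterS IH qadZ qfactS -scalerA; congr (_ *: _).
pose w a r : A := divpow v e a * x * divpow v e r.
pose c r : k := (-1) ^+ r * (t * v ^+ m.-1) ^+ r.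
have qadw r : (r <= m)%N -> qad (w (m - r)%N r) =
   qint v (m - r).+1 *: w (m - r).+1 r
   - (t * v ^+ m.*2 * qint v r.+1) *: w (m - r)%N r.+1.
  move=> rm.
  have cK j : conjK (divpow v e j) = v ^+ j.*2 *: divpow v e j.
    rewrite /divpow conjKZ scalerA mulrC -scalerA; congr (_ *: _).
    elim: j => [|j IHj]; first by rewrite !expr0 scale1r /conjK mulr1.
    rewrite !(exprS e) conjKM IHj (conjK_scale Ke) -scalerAl -scalerAr scalerA.
    by rewrite doubleS -exprD.
  rewrite /qad /w !conjKM !cK hx; congr (_ - _).
    by rewrite !mulrA mul_divpow -2!scalerAl.
  have gen (a b : k) (y z : A) :
      a *: y * (t *: x) * (b *: z) * e = (a * t * b) *: (y * x * (z * e)).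
    rewrite -(scalerAl a) -(scalerAr t) scalerA -(scalerAl (a * t)).
    by rewrite -(scalerAr b) scalerA -scalerAl !mulrA.
  rewrite gen divpow_mul -scalerAr scalerA; congr (_ *: _); congr (_ * _).
  by rewrite mulrAC -exprD -doubleD subnK // mulrC.
have -> : qad (\sum_(r < m.+1) c r *: w (m - r)%N r) =
   \sum_(r < m.+1) c r *: qad (w (m - r)%N r).
  rewrite (big_morph qad qadD qad0); apply: eq_bigr => r _; exact: qadZ.
have -> : \sum_(r < m.+1) c r *: qad (w (m - r)%N r) =
  \sum_(r < m.+1) (c r * qint v (m - r).+1) *: w (m - r).+1 r
   - \sum_(r < m.+1) (c r * (t * v ^+ m.*2 * qint v r.+1)) *: w (m - r)%N r.+1.
  rewrite -sumrB; apply: eq_bigr => r _.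
  by rewrite qadw ?scalerBr ?scalerA // -ltnS.
(* Both sums are extended to the range of the goal: the added end terms carry [qint v 0], which is 0
   and also makes the value of [r.-1] at 0 immaterial. *)
pose a r := c r * qint v (m.+1 - r).
pose b r := c r.-1 * (t * v ^+ m.*2 * qint v r).
have q0 : qint v 0 = 0 by rewrite /qint expr0 invr1 subrr mul0r.
have -> : \sum_(r < m.+1) (c r * qint v (m - r).+1) *: w (m - r).+1 r =
  \sum_(r < m.+2) a r *: w (m.+1 - r)%N r.
  rewrite [RHS]big_ord_recr /= /a subnn q0 mulr0 scale0r addr0.
  by apply: eq_bigr => r _; rewrite subSn // -ltnS.
have -> : \sum_(r < m.+1) (c r * (t * v ^+ m.*2 * qint v r.+1)) *: w (m - r)%N r.+1
   = \sum_(r < m.+2) b r *: w (m.+1 - r)%N r.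
  by rewrite [RHS]big_ord_recl /= /b q0 !mulr0 scale0r add0r.
rewrite -sumrB scaler_sumr; apply: eq_bigr => -[r /= hr] _.
rewrite ltnS in hr; rewrite -scalerBl scalerA; congr (_ *: _).
pose p : k := (-1) ^+ r * t ^+ r * v ^+ (m * r).
have -> : (-1) ^+ r * (t * v ^+ m) ^+ r = p by rewrite exprMn -exprM mulrA.
have -> : a r = p * (v ^- r * qint v (m.+1 - r)).
  rewrite /a /c /p; move: hr; rewrite leq_eqVlt => /orP[/eqP ->|].
    by rewrite subnn q0 !mulr0.
  rewrite ltnS exprMn -exprM => rm.
  have -> : (m * r = m.-1 * r + r)%N by case: m rm {IH c w qadw a b p} => [|m']; lia.
  by rewrite exprD -!mulrA mulVKf // expf_neq0.
have -> : b r = - (p * (v ^+ (m.+1 - r) * qint v r)).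
  rewrite /b /c /p -(mulrA (_ * _)); case: r hr {p} => [|r] hr.
    by rewrite q0 !mulr0 oppr0.
  have -> : v ^+ (m * r.+1) * (v ^+ (m.+1 - r.+1) * qint v r.+1) =
            v ^+ (m.-1 * r) * v ^+ m.*2 * qint v r.+1.
    rewrite mulrA -!exprD; congr (_ ^+ _ * _).
    by case: (m) hr => [|m']; lia.
  by rewrite exprMn -exprM /= !exprS; ring.
by rewrite opprK -mulrDr qint_shift // mulrC.
Qed.

(** At weight v^-m the factor t v^m of the expansion is 1. Reversing the summation puts
    [divpow v e r] on the left, at the cost of the global sign. *)
Lemma iter_qad_serre m x : conjK x = v ^- m *: x ->
  iter m.+1 qad x = (qfact v m.+1 * (-1) ^+ m.+1) *:
    \sum_(r < m.+2) (-1) ^+ r * (divpow v e r * x * divpow v e (m.+1 - r)).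
Proof.
move=> hx; rewrite (iter_qad_divpow m.+1 hx) mulVf ?expf_neq0 // -scalerA.
congr (_ *: _); rewrite scaler_sumr.
rewrite [LHS](reindex_inj rev_ord_inj); apply: eq_bigr => -[r /= hr] _.
rewrite ltnS in hr; rewrite subSS subKn // expr1n mulr1.
have -> : (-1) ^+ (m.+1 - r) = (-1) ^+ m.+1 * (-1) ^+ r :> k.
  by rewrite -signr_odd oddB // signr_addb !signr_odd.
rewrite -scalerA; congr (_ *: _).
by rewrite -(signr_odd _ r) -(signr_odd A r) mulr_sign scaler_sign.
Qed.

(** The scalar in [iter_qad_serre] is invertible. The forward direction gives the Serre relations of
    the image, the backward one extracts nilpotency from the defining relations. *)
Lemma qad_serreP m x : conjK x = v ^- m *: x ->
  iter m.+1 qad x = 0 <->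
  \sum_(r < m.+2) (-1) ^+ r * (divpow v e r * x * divpow v e (m.+1 - r)) = 0.
Proof.
move=> hx; rewrite iter_qad_serre //; split=> [h|->]; last by rewrite scaler0.
apply: (scalerI (a := qfact v m.+1 * (-1) ^+ m.+1)); last by rewrite h scaler0.
by rewrite mulf_neq0 ?qfact_neq0 // signr_eq0.
Qed.

Lemma divpow1 x : divpow v x 1 = x :> A.
Proof.
by rewrite /divpow /qfact big_nat1 /qint !expr1 mulfV // invr1 scale1r.
Qed.

Lemma divpow2 x : divpow v x 2 = (v + v^-1)^-1 *: (x * x) :> A.
Proof.
rewrite /divpow 2!qfactS /qfact big_geq // mul1r /qint expr1 mulfV // mul1r.
rewrite [x ^+ 2]expr2; congr (_^-1 *: _).
have -> : v ^+ 2 - v ^- 2 = (v + v^-1) * (v - v^-1).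
  by rewrite mulrC -subr_sqr exprVn.
by rewrite mulfK.
Qed.

(** This and the next two lemmas are T_i(E_j) for a_ij = 0, -1, -2. For n = 1, where a_10 = -4, it
    is T_0(E_1) that gets expanded, and a_01 = -1. *)
Lemma braid_sum0 x :
  \sum_(r < 1) ((-1) ^+ (r + 0) * v ^- r) *: (divpow v e (0 - r) * x * divpow v e r) = x.
Proof. by rewrite big_ord1 /= !divpow0 !expr0 invr1 mulr1 scale1r mul1r mulr1. Qed.

Lemma braid_sum1 x :
  \sum_(r < 2) ((-1) ^+ (r + 1) * v ^- r) *: (divpow v e (1 - r) * x * divpow v e r)
  = v^-1 *: (x * e) - e * x.
Proof.
rewrite big_ord_recl big_ord1 /= !divpow0 !divpow1 !mul1r !mulr1 expr0 invr1 mulr1.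
by rewrite !expr1 scaleN1r addrC sqrrN expr1n mul1r.
Qed.

Lemma braid_sum2 x :
  \sum_(r < 3) ((-1) ^+ (r + 2) * v ^- r) *: (divpow v e (2 - r) * x * divpow v e r)
  = (v + v^-1)^-1 *: (e * e * x - (1 + v ^- 2) *: (e * x * e) + v ^- 2 *: (x * e * e)).
Proof.
rewrite 2!big_ord_recl big_ord1 /= !divpow0 !divpow1 !divpow2 !mul1r !mulr1.
rewrite -[(0 + 2)%N]/2%N -[(bump 0 0 + 2)%N]/3%N -[(bump 0 (bump 0 0) + 2)%N]/4%N.
rewrite -[bump 0 (bump 0 0)]/2%N -[bump 0 0]/1%N.
have v2 : v + v^-1 != 0.
  apply: contraNneq (qint_neq0 (m := 2) isT) => h; apply/eqP.
  have -> : qint v 2 = (v + v^-1) * (v - v^-1) / (v - v^-1).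
    by rewrite /qint [_ * (v - _)]mulrC -subr_sqr exprVn.
  by rewrite h !mul0r.
have v3 : v * v + 1 != 0.
  apply: contraNneq v2 => h; apply/eqP.
  by rewrite -(mulfK v0 (v + v^-1)) mulrDl mulVf // h mul0r.
by nc k A tt; field; rewrite ?v0 ?v3 ?oner_neq0.
Qed.

End QAdjoint.

(** * Rank two *)

Section RankTwo.
Variables (k : fieldType) (v : k) (A : algType k).
Hypotheses (v0 : v != 0) (v2 : v ^+ 2 != 1) (v4 : v ^+ 4 != 1).

Let v2' : v ^+ 2 - 1 != 0.
Proof. by rewrite subr_eq0. Qed.
Let v4' : v ^+ 4 - 1 != 0.
Proof. by rewrite subr_eq0. Qed.
Let v2p : v ^+ 2 + 1 != 0.
Proof.
apply/eqP => h; move/eqP: v4'; apply.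
by have -> : v ^+ 4 - 1 = (v ^+ 2 + 1) * (v ^+ 2 - 1) by [ring]; rewrite h mul0r.
Qed.

Ltac nc_field := repeat split; try (by field; rewrite ?v0 ?v2' ?v2p ?v4').

Lemma commKi (K Ki y : A) (t : k) : K * Ki = 1 -> Ki * K = 1 -> t != 0 ->
  K * y = t *: (y * K) -> Ki * y = t^-1 *: (y * Ki).
Proof.
move=> KKi KiK t0 Ky; apply: (canRL (scalerK t0)).
rewrite -[RHS]mul1r -KiK -mulrA (mulrA K) Ky -scalerAl -(mulrA y) KKi mulr1.
by rewrite -scalerAr.
Qed.

(* e, f, K, Ki generate the quantum group at a vertex i, and x = E_j for a
   vertex j with a_ij = -1. *)
Section SimpleBond.
Variables (T : {lrmorphism A -> A}) (e f K Ki x : A).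
Hypotheses (KKi : K * Ki = 1) (KiK : Ki * K = 1).
Hypotheses (Ke : K * e = v ^+ 2 *: (e * K)) (Kx : K * x = v^-1 *: (x * K)).
Hypotheses (ef : e * f - f * e = (v - v^-1)^-1 *: (K - Ki)) (xf : x * f = f * x).
Hypotheses (Te : T e = - (f * K)) (Tx : T x = v^-1 *: (x * e) - e * x).

Lemma T_simple_inverse : T (v^-1 *: (e * x) - x * e) = x.
Proof.
rewrite rmorphB /= linearZ /= !rmorphM /= Te Tx.
have ef' : e * f = f * e + (v - v^-1)^-1 *: (K - Ki).
  by rewrite -ef addrC subrK.
have Kix : Ki * x = v *: (x * Ki) by rewrite (commKi KKi KiK _ Kx) ?invrK // invr_neq0.
nc k A (KKi, KiK, Ke, Kx, Kix, xf, ef').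
all: nc_field.
Qed.
End SimpleBond.

(* e, f, K, Ki generate the quantum group at the short vertex s of a double
   bond, and x = E_l, y = T_l E_s for the long vertex l, so that v_l = v ^ 2. *)
Section DoubleBond.
Variables (Ts Tl : {lrmorphism A -> A}) (e f K Ki x : A).
Hypotheses (KKi : K * Ki = 1) (KiK : Ki * K = 1).
Hypotheses (Ke : K * e = v ^+ 2 *: (e * K)) (Kx : K * x = v ^- 2 *: (x * K)).
Hypotheses (ef : e * f - f * e = (v - v^-1)^-1 *: (K - Ki)) (xf : x * f = f * x).
Hypotheses (Tse : Ts e = - (f * K)).
Hypothesis (Tsx : Ts x = (v + v^-1)^-1 *:
  (e * e * x - (1 + v ^- 2) *: (e * x * e) + v ^- 2 *: (x * e * e))).
Hypothesis (Tle : Tl e = v ^- 2 *: (e * x) - x * e).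
Hypothesis (TlV : Tl (v ^- 2 *: (x * e) - e * x) = e).

Let ef' : e * f = f * e + (v - v^-1)^-1 *: (K - Ki).
Proof. by rewrite -ef addrC subrK. Qed.
Let Kix : Ki * x = v ^+ 2 *: (x * Ki).
Proof. by rewrite (commKi KKi KiK _ Kx) ?invrK // invr_neq0 // expf_neq0. Qed.
Let Kie : Ki * e = v ^- 2 *: (e * Ki).
Proof. by rewrite (commKi KKi KiK _ Ke) // expf_neq0. Qed.

(** By [TlV] the right-hand side is the preimage of E_s under T_l, whence T_l T_s T_l fixes E_s. *)
Lemma Ts_Tl_short : Ts (Tl e) = v ^- 2 *: (x * e) - e * x.
Proof.
rewrite Tle rmorphB /= linearZ /= !rmorphM /= Tse Tsx.
nc k A (KKi, KiK, Ke, Kie, Kx, Kix, xf, ef').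
all: nc_field.
Qed.

(** Up to the scalar, T_s(E_l) is the commutator of T_l^-1(E_s) with E_s, which T_l turns into that
    of E_s with T_l(E_s). *)
Lemma Tl_Ts_long : Tl (Ts x) = (v + v^-1)^-1 *: (e * Tl e - Tl e * e).
Proof.
have -> : Ts x = (v + v^-1)^-1 *: ((v ^- 2 *: (x * e) - e * x) * e
    - e * (v ^- 2 *: (x * e) - e * x)).
  rewrite Tsx; congr (_ *: _); nc k A tt.
  all: nc_field.
by rewrite linearZ /= rmorphB /= !rmorphM /= TlV.
Qed.

Lemma Ts_Tl_Ts_long : Ts (Tl (Ts x)) = x.
Proof.
rewrite Tl_Ts_long linearZ /= rmorphB /= !rmorphM /= Ts_Tl_short Tse.
nc k A (KKi, KiK, Ke, Kie, Kx, Kix, xf, ef').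
all: nc_field.
Qed.

Lemma Tl_Ts_Tl_short : Tl (Ts (Tl e)) = e.
Proof. by rewrite Ts_Tl_short. Qed.

End DoubleBond.
End RankTwo.

(** * The presented algebra *)

Section KMonomials.
Variables (A : nzRingType) (I : finType) (K Ki : I -> A).
Hypotheses (KKi : forall i, K i * Ki i = 1) (KiK : forall i, Ki i * K i = 1).
Hypothesis KK : forall i j, K i * K j = K j * K i.

Let KiKC i j : Ki i * K j = K j * Ki i.
Proof.
rewrite -[K j * _]mul1r -(KiK i) -mulrA (mulrA (K i)) KK.
by rewrite -(mulrA (K j)) KKi mulr1.
Qed.

Let KiKi i j : Ki i * Ki j = Ki j * Ki i.
Proof.
rewrite -[Ki j * _]mul1r -(KiK i) -mulrA (mulrA (K i)) -KiKC.
by rewrite -(mulrA (Ki j)) KKi mulr1.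
Qed.

Definition kpow i (m : int) : A :=
  match m with Posz a => K i ^+ a | Negz a => Ki i ^+ a.+1 end.

Lemma kpow_comm i j a b : GRing.comm (kpow i a) (kpow j b).
Proof.
case: a => a; case: b => b; apply: commrX; apply: commr_sym; apply: commrX.
- exact: KK.
- exact: KiKC.
- by apply: commr_sym; exact: KiKC.
- exact: KiKi.
Qed.

Lemma kpowS i (m : int) : kpow i (m + 1) = kpow i m * K i.
Proof.
case: m => m; first by have -> : Posz m + 1 = m.+1%:Z by [lia]; rewrite /= exprSr.
have -> : Negz m + 1 = - m%:Z by lia.
rewrite /= exprSr -mulrA KiK mulr1.
by case: m => [|m]; rewrite ?oppr0 ?expr0.
Qed.

Lemma kpowP i (m : int) : kpow i (m - 1) = kpow i m * Ki i.
Proof. by rewrite -[m in RHS](subrK 1) kpowS -mulrA KKi mulr1. Qed.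

Lemma kpowD i (a b : int) : kpow i (a + b) = kpow i a * kpow i b.
Proof.
elim/int_rec: b => [|b IH|b IH]; first by rewrite addr0 mulr1.
  by rewrite -addn1 PoszD addrA kpowS IH -mulrA -kpowS.
by rewrite -addn1 PoszD opprD addrA kpowP IH -mulrA -kpowP.
Qed.

Lemma KprodD (lam mu : {ffun I -> int}) :
  Kprod K Ki (lam + mu) = Kprod K Ki lam * Kprod K Ki mu.
Proof.
rewrite /Kprod -prodrM_comm; last by move=> i j _ _; exact: kpow_comm.
by apply: eq_bigr => i _; rewrite ffunE; exact: kpowD.
Qed.

Lemma Kprod0 : Kprod K Ki 0 = 1.
Proof. by rewrite /Kprod big1 // => i _; rewrite ffunE. Qed.

Lemma Kprod_single (lam : {ffun I -> int}) i :
  (forall j, j != i -> lam j = 0) -> Kprod K Ki lam = kpow i (lam i).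
Proof.
move=> h; rewrite /Kprod (big_only1 i) // => j ji _.
by rewrite h.
Qed.

End KMonomials.

Lemma Kprod_alpha (A : nzRingType) n (K Ki : 'I_n.+1 -> A) i :
  Kprod K Ki (alpha i) = K i.
Proof.
rewrite (@Kprod_single _ _ _ _ _ i); first by rewrite ffunE eqxx.
by move=> j ji; rewrite ffunE eq_sym (negbTE ji).
Qed.

Lemma Kprod_alphaN (A : nzRingType) n (K Ki : 'I_n.+1 -> A) i :
  Kprod K Ki (- alpha i) = Ki i.
Proof.
rewrite (@Kprod_single _ _ _ _ _ i); first by rewrite !ffunE eqxx.
by move=> j ji; rewrite !ffunE eq_sym (negbTE ji) oppr0.
Qed.

(* Stated with the head symbol [feval] so that rewriting never has to unify
   under the presentation of the free algebra. *)
Section FevalMorphism.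
Variables (k : fieldType) (X : choiceType) (A : algType k) (f : X -> A).
Implicit Types x y : freeAlg k X.

Lemma fevalM x y : feval f (x * y) = feval f x * feval f y.
Proof. exact: rmorphM. Qed.
Lemma fevalB x y : feval f (x - y) = feval f x - feval f y.
Proof. exact: rmorphB. Qed.
Lemma fevalZ c x : feval f (c *: x) = c *: feval f x.
Proof. exact: linearZZ. Qed.
Lemma feval1 : feval f 1 = 1.
Proof. exact: rmorph1. Qed.
Lemma feval0 : feval f 0 = 0.
Proof. exact: rmorph0. Qed.
Lemma fevalX x m : feval f (x ^+ m) = feval f x ^+ m.
Proof. exact: rmorphXn. Qed.
Lemma feval_sum m (g : 'I_m -> freeAlg k X) :
  feval f (\sum_r g r) = \sum_r feval f (g r).
Proof. exact: rmorph_sum. Qed.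
Lemma feval_divpow v x m : feval f (divpow v x m) = divpow v (feval f x) m.
Proof. by rewrite /divpow [LHS]fevalZ [X in _ *: X]fevalX. Qed.
Lemma feval_sign m : feval f ((-1) ^+ m) = (-1) ^+ m.
Proof.
by rewrite [LHS]fevalX -[X in feval f X]scaleN1r [X in X ^+ m]fevalZ feval1 scaleN1r.
Qed.

Lemma feval_serre (v : k) x y m :
  feval f (\sum_(r < m.+1) (-1) ^+ r * (divpow v x r * y * divpow v x (m - r))) =
  \sum_(r < m.+1) (-1) ^+ r *
    (divpow v (feval f x) r * feval f y * divpow v (feval f x) (m - r)).
Proof.
rewrite [LHS]feval_sum; apply: eq_bigr => r _.
rewrite [LHS]fevalM [X in _ * X = _]fevalM [X in _ * (X * _) = _]fevalM feval_sign.
by congr (_ * (_ * _ * _)); rewrite [LHS]feval_divpow.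
Qed.

End FevalMorphism.

Section Relations.
Variables (k : fieldType) (q : k) (n : nat) (A : algType k).
Local Notation I := 'I_n.+1.
Variable f : qgen I -> A.
Hypothesis hf : forall l r, A2n2_rel q l r -> feval f l = feval f r.
Local Notation E i := (f (gE i)).
Local Notation F i := (f (gF i)).
Local Notation K i := (f (gK i)).
Local Notation Ki i := (f (gKi i)).

Let ev x : feval f (fgen k x) = f x := feval_gen f x.

Lemma rel_KKi (i : I) : K i * Ki i = 1.
Proof.
(* Generalizing [fgen] to a variable [G] keeps the rewriting from unfolding the free algebra; the
   same device recurs below. *)
have := hf (A2n2_KKi q i); move: (@fgen k (qgen I)) ev => G evg.
by rewrite fevalM feval1 !evg.
Qed.

Lemma rel_KiK (i : I) : Ki i * K i = 1.
Proof.
have := hf (A2n2_KiK q i); move: (@fgen k (qgen I)) ev => G evg.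
by rewrite fevalM feval1 !evg.
Qed.

Lemma rel_KK (i j : I) : K i * K j = K j * K i.
Proof.
have := hf (A2n2_KK q i j); move: (@fgen k (qgen I)) ev => G evg.
by rewrite [LHS]fevalM [RHS]fevalM !evg.
Qed.

Lemma rel_EF (i j : I) : E i * F j - F j * E i =
  if i == j then (qq q i - (qq q i)^-1)^-1 *: (K i - Ki i) else 0.
Proof.
have := hf (A2n2_EF q i j); move: (@fgen k (qgen I)) ev => G evg.
rewrite [LHS]fevalB [X in X - _ = _]fevalM [X in _ - X = _]fevalM !evg => ->.
case: eqP => _; last exact: feval0.
by rewrite [LHS]fevalZ [X in _ *: X]fevalB !evg.
Qed.

Lemma rel_KlE (lam : rootLattice n) i :
  let Kl := Kprod (fun i => K i) (fun i => Ki i) lam in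
  Kl * E i = q ^ Defs.form lam (alpha i) *: (E i * Kl).
Proof.
have := hf (A2n2_KE q lam i).
have <- : feval f (freeKl k lam) = Kprod (fun i => K i) (fun i => Ki i) lam.
  rewrite /freeKl /Kprod rmorph_prod; apply: eq_bigr => j _.
  by case: (lam j) => m; rewrite [LHS]fevalX ev.
move: (freeKl k lam) (@fgen k (qgen I)) ev => Kl G evg.
by rewrite [LHS]fevalM [RHS]fevalZ [X in _ *: X]fevalM !evg.
Qed.

Lemma rel_serre (i j : I) m : i != j -> cartan i j = - m%:Z ->
  \sum_(r < m.+2) (-1) ^+ r *
    (divpow (qq q i) (E i) r * E j * divpow (qq q i) (E i) (m.+1 - r)) = 0.
Proof.
move=> ij hm; have := hf (A2n2_serreE q ij).
have -> : serre q (fgen k (gE i)) (fgen k (gE j)) i j = \sum_(r < m.+2) (-1) ^+ r *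
    (divpow (qq q i) (fgen k (gE i)) r * fgen k (gE j) *
     divpow (qq q i) (fgen k (gE i)) (m.+1 - r)).
  by rewrite /serre hm opprK -PoszD absz_nat add1n.
move: (@fgen k (qgen I)) ev => G evg.
by rewrite [LHS]feval_serre [RHS]feval0 !evg.
Qed.

End Relations.

Section UqRelations.
Variables (k : fieldType) (q : k) (n : nat).
Local Notation I := 'I_n.+1.
Local Notation E := (UE q).
Local Notation F := (UF q).
Local Notation K := (UK q).
Local Notation Ki := (UKi q).

Definition ugen (g : qgen I) : UqA2n2 q n := @pgen k (A2n2_pres q n) g.

Lemma ugen_rel l r : A2n2_rel q l r -> feval ugen l = feval ugen r.
Proof. exact: (@pgen_rel k (A2n2_pres q n)). Qed.

Lemma UKKi (i : I) : K i * Ki i = 1.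
Proof. exact: (rel_KKi ugen_rel). Qed.

Lemma UKiK (i : I) : Ki i * K i = 1.
Proof. exact: (rel_KiK ugen_rel). Qed.

Lemma UKK (i j : I) : K i * K j = K j * K i.
Proof. exact: (rel_KK ugen_rel). Qed.

Lemma UEF (i j : I) : E i * F j - F j * E i =
  if i == j then (qq q i - (qq q i)^-1)^-1 *: (K i - Ki i) else 0.
Proof. exact: (rel_EF ugen_rel). Qed.

(** The weight relation at lam = alpha_i, since (alpha_i|alpha_j) = d_i a_ij. *)
Lemma UKE (i j : I) : K i * E j = qq q i ^ cartan i j *: (E j * K i).
Proof.
rewrite -(Kprod_alpha (@UK _ q n) (@UKi _ q n) i) /qq exprnP exprz_exp.
by rewrite -form_alpha; exact: (rel_KlE ugen_rel).
Qed.

Lemma Userre (i j : I) m : i != j -> cartan i j = - m%:Z ->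
  \sum_(r < m.+2) (-1) ^+ r *
    (divpow (qq q i) (E i) r * E j * divpow (qq q i) (E i) (m.+1 - r)) = 0.
Proof. exact: (rel_serre ugen_rel). Qed.

End UqRelations.

(** * Cartan integers, and q as a non-root of unity *)

Section Cartan.
Variable n : nat.
Local Notation nd := (@inord n).

(** Vertices are handled as natural numbers through [inord], so that case distinctions on them fall
    to [lia]. *)
Definition ddn (i : nat) : nat := if i == 0%N then 4 else if i == 1%N then 1 else 2.
Definition adjn (i j : nat) : bool :=
  [|| [&& 0 < i & j == i.+1], [&& 0 < j & i == j.+1],
      [&& i == n & j == 0] | [&& j == n & i == 0]]%N.

Lemma dd_inord i : (i <= n)%N -> dd (nd i) = ddn i.
Proof. by move=> hi; rewrite /dd inordK. Qed.

Lemma inord_eq i j : (i <= n)%N -> (j <= n)%N -> (nd i == nd j) = (i == j).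
Proof.
move=> hi hj; apply/eqP/eqP => [|-> //] /(congr1 (@nat_of_ord _)).
by rewrite !inordK.
Qed.

Lemma cartan_inord i j : (i <= n)%N -> (j <= n)%N ->
  cartan (nd i) (nd j) = if i == j then 2 else
    if adjn i j then - (maxn (ddn i) (ddn j) %/ ddn i)%N%:Z else 0.
Proof.
by move=> hi hj; rewrite /cartan inord_eq // /adj !dd_inord // !inordK.
Qed.

(** The bound excludes j = 1, where a_12 = -2; [cartan_down] admits it, as a_21 = -1. *)
Lemma cartan_up j : (1 < j < n)%N -> cartan (nd j) (nd j.+1) = -1.
Proof.
move=> hj; rewrite cartan_inord; [|lia|lia].
have -> : (j == j.+1) = false by lia.
have -> : adjn j j.+1 by rewrite /adjn; lia.
have -> : ddn j = 2 by rewrite /ddn; do !case: ifP; lia.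
by have -> : ddn j.+1 = 2 by rewrite /ddn; do !case: ifP; lia.
Qed.

Lemma cartan_down j : (0 < j < n)%N -> cartan (nd j.+1) (nd j) = -1.
Proof.
move=> hj; rewrite cartan_inord; [|lia|lia].
have -> : (j.+1 == j) = false by lia.
have -> : adjn j.+1 j by rewrite /adjn; lia.
have -> : ddn j.+1 = 2 by rewrite /ddn; do !case: ifP; lia.
rewrite /ddn; have -> : (j == 0)%N = false by lia.
by case: ifP.
Qed.

Lemma cartan12 : (1 < n)%N -> cartan (nd 1) (nd 2) = -2.
Proof. by move=> hn; rewrite cartan_inord; [|lia|lia]; rewrite /adjn /=. Qed.

Lemma cartan_n0 : (1 < n)%N -> cartan (nd n) (nd 0) = -2.
Proof.
move=> hn; rewrite cartan_inord //; have -> : (n == 0) = false by lia.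
rewrite /adjn eqxx !orbT /ddn; have -> : (n == 1) = false by lia.
by have -> : (n == 0) = false by lia.
Qed.

Lemma cartan_0n : (0 < n)%N -> cartan (nd 0) (nd n) = -1.
Proof.
move=> hn; rewrite cartan_inord //; have -> : (0 == n)%N = false by lia.
rewrite /adjn eqxx !orbT /ddn; have -> : (n == 0) = false by lia.
by case: ifP.
Qed.

Lemma cartan_n1_10 : n = 1%N -> cartan (nd 1) (nd 0) = -4.
Proof. by move=> hn; rewrite cartan_inord ?hn // /adjn hn. Qed.

Lemma cartan_far i j : (0 < i)%N -> (i.+1 < j <= n)%N -> cartan (nd i) (nd j) = 0.
Proof.
move=> hi hj; rewrite cartan_inord; [|lia|lia].
have -> : (i == j) = false by lia.
by have -> : adjn i j = false by rewrite /adjn; lia.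
Qed.

Lemma cartan_farr i j : (0 < i)%N -> (i.+1 < j <= n)%N -> cartan (nd j) (nd i) = 0.
Proof.
move=> hi hj; rewrite cartan_inord; [|lia|lia].
have -> : (j == i) = false by lia.
by have -> : adjn j i = false by rewrite /adjn; lia.
Qed.

Lemma cartan_far0 j : (0 < j < n)%N -> cartan (nd j) (nd 0) = 0.
Proof.
move=> hj; rewrite cartan_inord; [|lia|lia].
have -> : (j == 0)%N = false by lia.
by have -> : adjn j 0 = false by rewrite /adjn; lia.
Qed.

Lemma cartan_0far j : (0 < j < n)%N -> cartan (nd 0) (nd j) = 0.
Proof.
move=> hj; rewrite cartan_inord; [|lia|lia].
have -> : (0 == j)%N = false by lia.
by have -> : adjn 0 j = false by rewrite /adjn; lia.
Qed.

End Cartan.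

Section Qvar.
Variable R : realType.
Local Notation q := (qvar R).

Lemma qvar_neq0 : q != 0.
Proof. by rewrite /qvar tofrac_eq0 polyX_eq0. Qed.

Lemma qvar_exp_neq1 m : (0 < m)%N -> q ^+ m != 1.
Proof.
move=> hm; rewrite /qvar -rmorphXn -tofrac1 tofrac_eq; apply/eqP => h.
have := size_polyXn (R[i])%C m; rewrite h size_poly1; lia.
Qed.

End Qvar.

Section RootOfUnity.
Variables (k : fieldType) (v : k).
Hypotheses (v0 : v != 0) (v1 : forall m, (0 < m)%N -> v ^+ m != 1).

Lemma qint_neq0 m : (0 < m)%N -> qint v m != 0.
Proof.
have hv j : (0 < j)%N -> v ^+ j - v ^- j != 0.
  move=> hj; rewrite subr_eq0; apply: contraNneq (v1 (m := j + j) _); last lia.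
  by rewrite exprD => h; rewrite {1}h mulVf // expf_neq0.
move=> hm; rewrite /qint mulf_neq0 ?hv // invr_neq0 //.
by rewrite -[v]expr1 hv.
Qed.

Lemma qsub_neq0 : v - v^-1 != 0.
Proof.
rewrite subr_eq0; apply: contraNneq (v1 (m := 2) isT) => h.
by rewrite expr2 {1}h mulVf.
Qed.
End RootOfUnity.

(** * Braid group action *)

Section Braid.
Variables (k : fieldType) (q : k) (n : nat) (A : algType k).
Local Notation I := 'I_n.+1.
Local Notation nd := (@inord n).

(* Abstracting over the algebra keeps unification from unfolding the
   presentation of U_q(A_2n^(2)). *)
Record braided (E F K Ki : I -> A) (T : I -> {lrmorphism A -> A})
    (Tinv : I -> A -> A) (Om : A -> A) : Prop := Braided {
  br_q0 : q != 0;
  br_q1 : forall m, (0 < m)%N -> q ^+ m != 1;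
  br_KKi : forall i, K i * Ki i = 1;
  br_KiK : forall i, Ki i * K i = 1;
  br_KK : forall i j, K i * K j = K j * K i;
  br_KE : forall i j, K i * E j = qq q i ^ cartan i j *: (E j * K i);
  br_EF : forall i j, E i * F j - F j * E i =
    if i == j then (qq q i - (qq q i)^-1)^-1 *: (K i - Ki i) else 0;
  br_serre : forall i j m, i != j -> cartan i j = - m%:Z ->
    \sum_(r < m.+2) (-1) ^+ r *
      (divpow (qq q i) (E i) r * E j * divpow (qq q i) (E i) (m.+1 - r)) = 0;
  br_T : forall i, cancel (T i) (Tinv i);
  br_Tinv : forall i, cancel (Tinv i) (T i);
  br_comm : forall i j x, i != j -> cartan i j = 0 -> T i (T j x) = T j (T i x);
  br_braid : forall i j x, i != j -> cartan i j = -1 -> cartan j i = -1 ->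
    T i (T j (T i x)) = T j (T i (T j x));
  br_TKl : forall i lam, T i (Kprod K Ki lam) = Kprod K Ki (refl i lam);
  br_TEi : forall i, T i (E i) = - (F i * K i);
  br_TEj : forall i j m, i != j -> cartan i j = - m%:Z ->
    T i (E j) = \sum_(r < m.+1) ((-1) ^+ (r + m) * qq q i ^- r) *:
      (divpow (qq q i) (E i) (m - r) * E j * divpow (qq q i) (E i) r);
  br_TOm : forall i x, T i (Om x) = Om (T i x);
  br_OmD : forall x y, Om (x + y) = Om x + Om y;
  br_OmM : forall x y, Om (x * y) = Om y * Om x;
  br_Om1 : Om 1 = 1;
  br_OmZ : forall x, Om (q *: x) = q^-1 *: Om x;
  br_OmE : forall i, Om (E i) = F i;
  br_OmF : forall i, Om (F i) = E i;
  br_OmK : forall i, Om (K i) = Ki i }.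

Variables (E F K Ki : I -> A) (T : I -> {lrmorphism A -> A}).
Variables (Tinv : I -> A -> A) (Om : A -> A).
Hypothesis H : braided E F K Ki T Tinv Om.

Lemma qq_neq0 (i : I) : qq q i != 0.
Proof. by rewrite expf_neq0 // (br_q0 H). Qed.

Lemma qq_exp_neq1 (i : I) m : (0 < m)%N -> qq q i ^+ m != 1.
Proof.
move=> hm; rewrite /qq -exprM (br_q1 H) // muln_gt0 hm andbT /dd.
by do 2?case: ifP.
Qed.

Definition ad (i : I) : A -> A := qad (E i) (K i) (Ki i).

Lemma KE_same (i : I) : K i * E i = qq q i ^+ 2 *: (E i * K i).
Proof. by rewrite (br_KE H) /cartan eqxx. Qed.

Lemma conjK_E (i j : I) : conjK (K i) (Ki i) (E j) = qq q i ^ cartan i j *: E j.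
Proof. by apply: conjK_scale; [exact: (br_KKi H) | exact: (br_KE H)]. Qed.

Lemma ad_serre (i j : I) m : i != j -> cartan i j = - m%:Z ->
  iter m.+1 (ad i) (E j) = 0.
Proof.
move=> ij hm; have hv := qq_neq0 i.
have vv := qsub_neq0 hv (@qq_exp_neq1 i).
apply/(qad_serreP (br_KKi H i) (br_KiK H i) hv (KE_same i) vv).
- exact: qint_neq0 hv (@qq_exp_neq1 i).
- by rewrite conjK_E hm exprnN.
- exact: (br_serre H).
Qed.

Lemma T_far (i j : I) : i != j -> cartan i j = 0 -> T i (E j) = E j.
Proof. by move=> ij hij; rewrite (br_TEj H (m := 0) ij hij) braid_sum0. Qed.

Lemma T_simple (i j : I) : i != j -> cartan i j = -1 ->
  T i (E j) = (qq q i)^-1 *: (E j * E i) - E i * E j.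
Proof.
move=> ij hij; rewrite (br_TEj H (m := 1) ij hij) braid_sum1 //.
exact: qsub_neq0 (qq_neq0 i) (@qq_exp_neq1 i).
Qed.

Lemma T_double (i j : I) : i != j -> cartan i j = -2 ->
  let v := qq q i in
  T i (E j) = (v + v^-1)^-1 *:
  (E i * E i * E j - (1 + v ^- 2) *: (E i * E j * E i) + v ^- 2 *: (E j * E i * E i)).
Proof.
move=> ij hij v; rewrite (br_TEj H (m := 2) ij hij) braid_sum2 ?qq_neq0 //.
  exact: qsub_neq0 (qq_neq0 i) (@qq_exp_neq1 i).
exact: qint_neq0 (qq_neq0 i) (@qq_exp_neq1 i).
Qed.

Lemma EF_far (i j : I) : i != j -> E i * F j = F j * E i.
Proof. by move=> ij; apply/eqP; rewrite -subr_eq0 (br_EF H) (negbTE ij). Qed.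

Lemma EF_same (i : I) :
  E i * F i - F i * E i = (qq q i - (qq q i)^-1)^-1 *: (K i - Ki i).
Proof. by rewrite (br_EF H) eqxx. Qed.

Lemma T_simpleV (i j : I) : i != j -> cartan i j = -1 ->
  T i ((qq q i)^-1 *: (E i * E j) - E j * E i) = E j.
Proof.
move=> ij hij.
have hKE : K i * E j = (qq q i)^-1 *: (E j * K i) by rewrite (br_KE H) hij exprN1.
have EF : E j * F i = F i * E j by rewrite EF_far // eq_sym.
exact: (T_simple_inverse (qq_neq0 i) (@qq_exp_neq1 i 2 isT) (br_KKi H i) (br_KiK H i)
  (KE_same i) hKE (EF_same i) EF (br_TEi H i) (T_simple ij hij)).
Qed.

Lemma Tinv_simple (i j : I) : i != j -> cartan i j = -1 ->
  Tinv i (E j) = (qq q i)^-1 *: (E i * E j) - E j * E i.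
Proof. by move=> ij hij; rewrite -[X in Tinv i X](T_simpleV ij hij) (br_T H). Qed.

Section DoubleBond.
Variables s l : I.
Hypotheses (sl : s != l) (hsl : cartan s l = -2) (hls : cartan l s = -1).
Hypothesis ddl : dd l = (dd s).*2.

Let v := qq q s.
Let qql : (qq q l)^-1 = v ^- 2.
Proof. by rewrite /v /qq ddl -exprM muln2. Qed.
Let ls : l != s.
Proof. by rewrite eq_sym. Qed.

Let Tle : T l (E s) = v ^- 2 *: (E s * E l) - E l * E s.
Proof. by rewrite T_simple // qql. Qed.
Let TlV : T l (v ^- 2 *: (E l * E s) - E s * E l) = E s.
Proof. by rewrite -qql T_simpleV. Qed.
Let KE : K s * E l = v ^- 2 *: (E l * K s).
Proof. by rewrite (br_KE H) hsl -exprnN. Qed.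

Let EF : E l * F s = F s * E l := EF_far ls.
Let v2 : v ^+ 2 != 1 := @qq_exp_neq1 s 2 isT.
Let v4 : v ^+ 4 != 1 := @qq_exp_neq1 s 4 isT.

(** Used for (s, l) = (1, 2), while [T_sls_long] and [Tinv_double] serve (s, l) = (n, 0): these are
    the two double bonds of the diagram when n > 1. *)
Lemma T_lsl_short : T l (T s (T l (E s))) = E s.
Proof.
exact: (Tl_Ts_Tl_short (qq_neq0 s) v2 v4 (br_KKi H s) (br_KiK H s) (KE_same s) KE
  (EF_same s) EF (br_TEi H s) (T_double sl hsl) Tle TlV).
Qed.

Lemma T_sls_long : T s (T l (T s (E l))) = E l.
Proof.
exact: (Ts_Tl_Ts_long (qq_neq0 s) v2 v4 (br_KKi H s) (br_KiK H s) (KE_same s) KE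
  (EF_same s) EF (br_TEi H s) (T_double sl hsl) Tle TlV).
Qed.

Lemma Tinv_double : Tinv s (E l) =
  (v + v^-1)^-1 *: (E s * T l (E s) - T l (E s) * E s).
Proof.
have <- : T l (T s (E l)) = (v + v^-1)^-1 *: (E s * T l (E s) - T l (E s) * E s).
  exact: (Tl_Ts_long (qq_neq0 s) (T_double sl hsl) TlV).
by rewrite -[X in Tinv s X]T_sls_long (br_T H).
Qed.

End DoubleBond.
End Braid.

(** * The Coxeter element and its powers *)

Section CoxeterElement.
Variables (k : fieldType) (q : k) (n : nat) (A : algType k).
Local Notation I := 'I_n.+1.
Local Notation nd := (@inord n).
Variables (E F K Ki : I -> A) (T : I -> {lrmorphism A -> A}).
Variables (Tinv : I -> A -> A) (Om : A -> A).
Hypothesis H : braided q E F K Ki T Tinv Om.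
Hypothesis hn : (1 < n)%N.

(* T_(m+l-1) ... T_(m+1) T_m *)
Definition chain (m l : nat) (x : A) : A :=
  foldr (fun j y => T (nd j) y) x (rev (iota m l)).

Definition cox (x : A) : A := T (nd 0) (chain 1 n x).

Lemma chainS m l x : chain m l.+1 x = T (nd (m + l)) (chain m l x).
Proof. by rewrite /chain -addn1 iotaD rev_cat. Qed.

Lemma chainSl m l x : chain m l.+1 x = chain m.+1 l (T (nd m) x).
Proof. by rewrite /chain /= rev_cons foldr_rcons. Qed.

Lemma chain_cat m a b x : chain m (a + b) x = chain (m + a) b (chain m a x).
Proof. by rewrite /chain iotaD rev_cat foldr_cat. Qed.

Lemma chain_fix m l x : (forall j, (m <= j < m + l)%N -> T (nd j) x = x) ->
  chain m l x = x.
Proof.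
elim: l => // l IH h; rewrite chainS IH ?h //; first by lia.
by move=> j hj; apply: h; lia.
Qed.

Lemma chain_comm i m l x :
  (forall j y, (m <= j < m + l)%N -> T i (T (nd j) y) = T (nd j) (T i y)) ->
  T i (chain m l x) = chain m l (T i x).
Proof.
elim: l => // l IH h; rewrite !chainS h ?IH //; last lia.
by move=> j y hj; apply: h; lia.
Qed.

Let nd_neq i j : (i <= n)%N -> (j <= n)%N -> i != j -> nd i != nd j.
Proof. by move=> hi hj ij; rewrite inord_eq. Qed.

Lemma T_comm_lt i j x : (0 < i)%N -> (i.+1 < j <= n)%N ->
  T (nd i) (T (nd j) x) = T (nd j) (T (nd i) x).
Proof.
by move=> hi hj; apply: (br_comm H); [apply: nd_neq; lia | exact: cartan_far].
Qed.

Lemma T_comm0 j x : (0 < j < n)%N -> T (nd j) (T (nd 0) x) = T (nd 0) (T (nd j) x).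
Proof.
by move=> hj; apply: (br_comm H); [apply: nd_neq; lia | exact: cartan_far0].
Qed.

Lemma T_braid j x : (1 < j < n)%N ->
  T (nd j) (T (nd j.+1) (T (nd j) x)) = T (nd j.+1) (T (nd j) (T (nd j.+1) x)).
Proof.
move=> hj; apply: (br_braid H); first by apply: nd_neq; lia.
  exact: cartan_up.
by apply: cartan_down; lia.
Qed.

(** T_(j+1) passes T_1, ..., T_(j-1), the braid relation with the factors T_(j+1) T_j of c turns it
    into T_j, and this passes T_(j+2), ..., T_n and T_0. *)
Lemma cox_shift j x : (1 < j < n)%N -> cox (T (nd j.+1) x) = T (nd j) (cox x).
Proof.
move=> hj; rewrite /cox T_comm0; last lia.
have split y : chain 1 n y =
    chain j.+2 (n - j.+1) (T (nd j.+1) (T (nd j) (chain 1 j.-1 y))).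
  have {1}-> : n = (j.-1 + 2 + (n - j.+1))%N by lia.
  rewrite !chain_cat /chain /=.
  by have -> : (1 + j.-1)%N = j by [lia]; have -> : (1 + (j.-1 + 2))%N = j.+2 by lia.
rewrite !split [X in _ = T _ X]chain_comm; last first.
  by move=> i y hi; rewrite T_comm_lt //; lia.
rewrite T_braid // (chain_comm (i := nd j.+1)) // => i y hi.
by rewrite -T_comm_lt //; lia.
Qed.

Lemma chain_cox m l x : (1 < m)%N -> (m + l <= n)%N ->
  chain m l (cox x) = cox (chain m.+1 l x).
Proof.
move=> hm; elim: l => // l IH hl; rewrite !chainS IH; last lia.
by rewrite addSn cox_shift //; lia.
Qed.

(** The hypotheses give T_n c x = T_n T_0 T_n x = x. Since [chain_cox] carries the other factors of
    the chain across c, each T_n uses up one power of c. *)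
Lemma chain_iter_cox x : (forall j, (0 < j < n)%N -> T (nd j) x = x) ->
  T (nd n) (T (nd 0) (T (nd n) x)) = x ->
  chain 2 n.-1 (iter n.-1 cox x) = x.
Proof.
move=> hx hnx.
have Tn_cox : T (nd n) (cox x) = x.
  rewrite /cox -[X in chain 1 X](ltn_predK hn) chainS chain_fix; last first.
    by move=> j hj; apply: hx; lia.
  by have -> : (1 + n.-1)%N = n by lia.
have main l : (l <= n.-1)%N -> chain (n.+1 - l) l (iter l cox x) = x.
  elim: l => // l IH hl; rewrite iterS chainS.
  have -> : (n.+1 - l.+1 + l)%N = n by lia.
  rewrite chain_cox; [|lia|lia].
  have -> : (n.+1 - l.+1).+1 = (n.+1 - l)%N by lia.
  by rewrite IH //; lia.
by have := main n.-1 (leqnn _); have -> : (n.+1 - n.-1)%N = 2 by lia.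
Qed.

(** The mirror image of [chain_iter_cox]: here c T_2 x = x, and each power of c uses up one T_2. *)
Lemma iter_cox_chain x : T (nd 0) x = x ->
  (forall j, (2 < j <= n)%N -> T (nd j) x = x) ->
  T (nd 2) (T (nd 1) (T (nd 2) x)) = x ->
  iter n.-1 cox (chain 2 n.-1 x) = x.
Proof.
move=> h0 hx h2.
have cox_T2 : cox (T (nd 2) x) = x.
  rewrite /cox -[X in chain 1 X](subnKC hn) chain_cat {2}/chain /= h2 chain_fix //.
  by move=> j hj; apply: hx; lia.
have main l : (l <= n.-1)%N -> iter l cox (chain 2 l x) = x.
  elim: l => // l IH hl; rewrite iterSr chainSl -chain_cox; [|lia|lia].
  by rewrite cox_T2 IH //; lia.
exact: main.
Qed.

Lemma chain_lrmorphism m l :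
  exists g : {lrmorphism A -> A}, forall x, g x = chain m l x.
Proof.
elim: l => [|l [g hg]]; first by exists idfun.
exists (T (nd (m + l)) \o g : {lrmorphism A -> A}) => x.
by rewrite chainS /= hg.
Qed.

(** As a bundled morphism a power of c transports whole relations, Serre sums included; commutation
    with [Om] covers F_0 as well. *)
Lemma iter_cox_lrmorphism l :
  exists2 g : {lrmorphism A -> A}, forall x, g x = iter l cox x &
    forall x, g (Om x) = Om (g x).
Proof.
have chainOm m j x : chain m j (Om x) = Om (chain m j x).
  by elim: j => // j IH; rewrite !chainS IH (br_TOm H).
have [c hc] := chain_lrmorphism 1 n.
elim: l => [|l [g hg gOm]]; first by exists idfun.
exists (T (nd 0) \o c \o g : {lrmorphism A -> A}) => x /=.
  by rewrite hg hc.
by rewrite gOm !hc chainOm (br_TOm H).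
Qed.

End CoxeterElement.

(* [hdeg G S i d x]: x is a combination of words in the G j, where each word has
   d letters G i and all its other letters are among the G j with S j. *)
Inductive hdeg (k : fieldType) (A : algType k) (G : nat -> A) (S : nat -> Prop)
    (i : nat) : nat -> A -> Prop :=
| hdeg_out j : S j -> hdeg G S i 0 (G j)
| hdeg_in : hdeg G S i 1 (G i)
| hdegD d x y : hdeg G S i d x -> hdeg G S i d y -> hdeg G S i d (x + y)
| hdegZ d c x : hdeg G S i d x -> hdeg G S i d (c *: x)
| hdegM a b x y : hdeg G S i a x -> hdeg G S i b y -> hdeg G S i (a + b) (x * y).

Section HomogeneousDegree.
Variables (k : fieldType) (A : algType k) (G : nat -> A).

Lemma hdegB S i d x y : hdeg G S i d x -> hdeg G S i d y -> hdeg G S i d (x - y).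
Proof. by move=> hx hy; rewrite -scaleN1r; apply: hdegD => //; apply: hdegZ. Qed.

Lemma hdeg_qcomm S i a b c x y : hdeg G S i a x -> hdeg G S i b y ->
  hdeg G S i (a + b) (c *: (x * y) - y * x).
Proof.
move=> hx hy; apply: hdegB; first by apply: hdegZ; apply: hdegM.
by rewrite addnC; apply: hdegM.
Qed.

Lemma hdeg_map (f : A -> A) S S' i i' :
  {morph f : x y / x + y} -> {morph f : x y / x * y} ->
  (forall c, {morph f : x / c *: x}) ->
  (forall j, S j -> hdeg G S' i' 0 (f (G j))) -> hdeg G S' i' 1 (f (G i)) ->
  forall d x, hdeg G S i d x -> hdeg G S' i' d (f x).
Proof.
move=> fD fM fZ h0 h1 d x; elim=> {d x} [j /h0 //|//|d x y _ hx _ hy|d c x _ hx|].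
- by rewrite fD; apply: hdegD.
- by rewrite fZ; apply: hdegZ.
by move=> a b x y _ hx _ hy; rewrite fM; apply: hdegM.
Qed.

End HomogeneousDegree.

(** * Word descriptions of the root vectors *)

Section Degrees.
Variables (k : fieldType) (q : k) (n : nat) (A : algType k).
Local Notation I := 'I_n.+1.
Local Notation nd := (@inord n).
Variables (E F K Ki : I -> A) (T : I -> {lrmorphism A -> A}).
Variables (Tinv : I -> A -> A) (Om : A -> A).
Hypothesis H : braided q E F K Ki T Tinv Om.
Local Notation G := (fun j : nat => E (nd j)).
Local Notation ad := (ad E K Ki).

Section AtVertex.
Variables (p : I) (S : nat -> Prop) (i m : nat).
Hypothesis pS : forall j, S j -> p != nd j /\ cartan p (nd j) = 0.
Hypotheses (pi : p != nd i) (cpi : cartan p (nd i) = - m%:Z).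
Let v := qq q p.
Let KKi := br_KKi H p.
Let KiK := br_KiK H p.

(** No word of [x] contains the letter E_p. *)
Lemma hdeg_commF d x : hdeg G S i d x -> x * F p = F p * x.
Proof.
elim=> {d x} [j /pS[pj _]||d x y _ hx _ hy|d c x _ hx|a b x y _ hx _ hy].
- by apply: (EF_far H); rewrite eq_sym.
- by apply: (EF_far H); rewrite eq_sym.
- by rewrite mulrDl mulrDr hx hy.
- by rewrite -scalerAl -scalerAr hx.
by rewrite -mulrA hy !mulrA hx.
Qed.

Lemma hdeg_conjK d x : hdeg G S i d x -> conjK (K p) (Ki p) x = (v ^- m) ^+ d *: x.
Proof.
elim=> {d x} [j /pS[_ pj]||d x y _ hx _ hy|d c x _ hx|a b x y _ hx _ hy].
- by rewrite (conjK_E H) pj expr0z expr0.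
- by rewrite (conjK_E H) cpi -exprnN expr1.
- by rewrite conjKD hx hy scalerDr.
- by rewrite conjKZ hx !scalerA mulrC.
by rewrite conjKM // hx hy -scalerAl -scalerAr scalerA exprD.
Qed.

(** By [iter_qadM] the nilpotency order minus one adds up over a product, each letter G i
    contributing m and the others 0. The uses are m = d = 2 at vertex 1, of order 5, and m = d = 1
    at vertex 0, of order 2. *)
Lemma hdeg_ad d x : hdeg G S i d x -> iter (m * d).+1 (ad p) x = 0.
Proof.
elim=> {d x} [j /pS[pj cpj]||d x y _ hx _ hy|d c x _ hx|a b x y _ hx _ hy].
- by rewrite muln0; apply: (ad_serre H (m := 0) pj).
- by rewrite muln1; apply: (ad_serre H pi).
- by rewrite /ad iter_qadD hx hy addr0.
- by rewrite /ad iter_qadZ hx scaler0.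
have := iter_qadM KKi KiK (qq_neq0 H p) (KE_same H p) hx hy.
by rewrite addSn addnS mulnDr.
Qed.

Hypothesis m1 : m = 1%N.

(** Degrees 0 and 1 are proved together because a product of degree 1 splits as 0 + 1 or 1 + 0; a
    factor of degree 0 is fixed by T_p and passes through [ad p]. *)
Lemma hdeg_T d x : hdeg G S i d x ->
  (d = 0%N -> T p x = x) /\ (d = 1%N -> T p x = - ad p x).
Proof.
elim=> {d x} [j /pS[pj cpj]||d x y _ [x0 x1] _ [y0 y1]|d c x _ [x0 x1]|].
- by split=> // _; apply: (T_far H).
- split=> // _; rewrite (T_simple H pi) ?cpi ?m1 // /ad /qad (conjK_E H) cpi m1.
  rewrite exprN1 -scalerAl opprB; reflexivity.
- split=> d0; first by rewrite rmorphD /= x0 ?y0.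
  by rewrite rmorphD /= x1 ?y1 // -opprD /ad qadD.
- split=> d0; first by rewrite linearZ /= x0.
  rewrite linearZ /= x1 // /ad qadZ scalerN; reflexivity.
move=> [|[|a]] [|[|b]] x y hx [x0 x1] hy [y0 y1]; split=> // _; rewrite rmorphM /=.
- by rewrite x0 ?y0.
- rewrite x0 // y1 // /ad qad_comm_mull ?mulrN //.
    by rewrite (hdeg_conjK hx) expr0 scale1r.
  by have := hdeg_ad hx; rewrite muln0.
- rewrite x1 // y0 // /ad qad_comm_mulr ?mulNr //.
  by have := hdeg_ad hy; rewrite muln0.
Qed.

End AtVertex.

Hypothesis hn : (1 < n)%N.

Let nd_neq i j : (i <= n)%N -> (j <= n)%N -> i != j -> nd i != nd j.
Proof. by move=> hi hj ij; rewrite inord_eq. Qed.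

Section TinvMorphism.
Variable i : I.
Let TinvE x y : T i y = x -> Tinv i x = y.
Proof. by move=> <-; exact: (br_T H). Qed.
Lemma TinvD : {morph Tinv i : x y / x + y}.
Proof. by move=> x y; apply: TinvE; rewrite rmorphD /= !(br_Tinv H). Qed.
Lemma TinvM : {morph Tinv i : x y / x * y}.
Proof. by move=> x y; apply: TinvE; rewrite rmorphM /= !(br_Tinv H). Qed.
Lemma TinvZ c : {morph Tinv i : x / c *: x}.
Proof. by move=> x; apply: TinvE; rewrite linearZ /= (br_Tinv H). Qed.
Lemma Tinv_far j : i != j -> cartan i j = 0 -> Tinv i (E j) = E j.
Proof. by move=> ij cij; apply: TinvE; apply: (T_far H). Qed.
End TinvMorphism.

Definition above (m j : nat) : Prop := j = 0%N \/ (m < j <= n)%N.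
Definition below (m j : nat) : Prop := (0 < j < m)%N.

(** The origin of the degree 2: [Tinv_double] is a commutator of E_n with T_0(E_n), itself a
    q-commutator of E_n and E_0. *)
Lemma hdeg_Tinv_n_E0 : hdeg G (above n) n 2 (Tinv (nd n) (E (nd 0))).
Proof.
have n0 : nd n != nd 0 by apply: nd_neq; lia.
rewrite (Tinv_double H n0); first last.
- rewrite !dd_inord // /ddn.
  have -> : (n == 0)%N = false by lia.
  by have -> : (n == 1)%N = false by lia.
- by apply: cartan_0n; lia.
- exact: cartan_n0.
rewrite (T_simple H) 1?eq_sym //; last by apply: cartan_0n; lia.
have hE0 : hdeg G (above n) n 0 (E (nd 0)) by apply: (@hdeg_out _ _ G); left.
have hEn : hdeg G (above n) n 1 (E (nd n)) := hdeg_in _ _ _.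
have hB := hdeg_qcomm (qq q (nd 0))^-1 hEn hE0.
apply: hdegZ; rewrite -[X in X - _]scale1r.
exact: (hdeg_qcomm 1 hEn hB).
Qed.

(** T_m^-1 fixes the outer letters and makes E_(m+1) a q-commutator of E_m and E_(m+1): the latter
    becomes an outer letter and its count passes to E_m. *)
Lemma hdeg_Tinv m d x : (1 < m < n)%N ->
  hdeg G (above m.+1) m.+1 d x -> hdeg G (above m) m d (Tinv (nd m) x).
Proof.
move=> hm; apply: hdeg_map; [exact: TinvD|exact: TinvM|exact: TinvZ| |].
  move=> j [->|hj].
    rewrite Tinv_far; [|by apply: nd_neq; lia|by apply: cartan_far0; lia].
    by apply: (@hdeg_out _ _ G); left.
  rewrite Tinv_far; [|by apply: nd_neq; lia|by apply: cartan_far; lia].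
  by apply: (@hdeg_out _ _ G); right; lia.
have mm : nd m != nd m.+1 by apply: nd_neq; lia.
rewrite (Tinv_simple H mm (cartan_up hm)).
apply: (hdeg_qcomm _ (hdeg_in _ _ _) (b := 0)).
by apply: (@hdeg_out _ _ G); right; lia.
Qed.

Lemma hdeg_chain_inv y : chain T 2 n.-1 y = E (nd 0) -> hdeg G (above 2) 2 2 y.
Proof.
have main l z : (0 < l <= n.-1)%N -> chain T (n.+1 - l) l z = E (nd 0) ->
    hdeg G (above (n.+1 - l)) (n.+1 - l) 2 z.
  elim: l z => // -[_ z _|l IH z hl].
    rewrite subn1 /= => hz; rewrite -(br_T H (nd n) z).
    rewrite [T _ z]hz; exact: hdeg_Tinv_n_E0.
  rewrite chainSl; have e : (n.+1 - l.+2).+1 = (n.+1 - l.+1)%N by lia.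
  rewrite e => /IH h; rewrite -(br_T H (nd (n.+1 - l.+2)) z).
  by apply: hdeg_Tinv; [lia | rewrite e; apply: h; lia].
have := main n.-1 y; have -> : (n.+1 - n.-1)%N = 2 by lia.
by apply; lia.
Qed.

(** The count moves upwards here, from E_1 to E_n: each T_(l+1) turns the single E_l into a
    q-commutator of E_l and E_(l+1). *)
Lemma hdeg_chain : hdeg G (below n) n 1 (chain T 2 n.-1 (E (nd 1))).
Proof.
have main l : (l <= n.-1)%N -> hdeg G (below l.+1) l.+1 1 (chain T 2 l (E (nd 1))).
  elim: l => [|l IH] hl; first exact: (@hdeg_in _ _ G).
  rewrite chainS add2n; apply: hdeg_map (IH _); last lia.
  - exact: rmorphD.
  - exact: rmorphM.
  - by move=> c x; exact: linearZZ.
  - move=> j hj; rewrite (T_far H).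
    + by apply: (@hdeg_out _ _ G); rewrite /below in hj *; lia.
    + by apply: nd_neq; rewrite /below in hj; lia.
    + by apply: cartan_farr; rewrite /below in hj; lia.
  rewrite (T_simple H); [|by apply: nd_neq; lia|by apply: cartan_down; lia].
  apply: (hdeg_qcomm _ (a := 0) (b := 1)); last exact: (@hdeg_in _ _ G).
  by apply: (@hdeg_out _ _ G); rewrite /below; lia.
have := main n.-1 (leqnn _); by have -> : n.-1.+1 = n by lia.
Qed.

End Degrees.

(** * Reflections on the root lattice *)

Section Reflections.
Variable n : nat.
Local Notation I := 'I_n.+1.
Local Notation nd := (@inord n).

Lemma reflD (i : I) (lam mu : rootLattice n) :
  refl i (lam + mu) = refl i lam + refl i mu.
Proof.
rewrite /refl addrACA -opprD -mulrzDr; congr (_ - _ *~ _).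
by rewrite -big_split; apply: eq_bigr => j _; rewrite ffunE mulrDl.
Qed.

Lemma refl_fix (i j : I) : cartan i j = 0 -> refl i (alpha j) = alpha j.
Proof. by move=> h; rewrite refl_alpha h mulr0z subr0. Qed.

(** The weight counterpart of T_n T_0 T_n (E_0) = E_0, which lets [chain_iter_cox] apply to K_0. *)
Lemma refl_n0n : (1 < n)%N ->
  refl (nd n) (refl (nd 0) (refl (nd n) (alpha (nd 0)))) = alpha (nd 0).
Proof.
move=> hn; have e0 : refl (nd n) (alpha (nd 0)) =
    alpha (nd 0) + (alpha (nd n) + alpha (nd n)).
  by rewrite refl_alpha cartan_n0 // mulrNz opprK -[2]/(2%:Z) -pmulrn mulr2n.
have e1 : refl (nd 0) (alpha (nd 0)) = - alpha (nd 0).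
  by rewrite refl_alpha /cartan eqxx -[2]/(2%:Z) -pmulrn mulr2n opprD addrA subrr add0r.
have e2 : refl (nd 0) (alpha (nd n)) = alpha (nd n) + alpha (nd 0).
  by rewrite refl_alpha cartan_0n ?mulrN1z ?opprK //; lia.
have e3 : refl (nd n) (alpha (nd n)) = - alpha (nd n).
  by rewrite refl_alpha /cartan eqxx -[2]/(2%:Z) -pmulrn mulr2n opprD addrA subrr add0r.
have e4 : - alpha (nd 0) + (alpha (nd n) + alpha (nd 0) + (alpha (nd n) + alpha (nd 0)))
  = alpha (nd 0) + (alpha (nd n) + alpha (nd n)).
  by apply/ffunP => j; rewrite !ffunE; lia.
rewrite e0 !(reflD (nd 0)) e1 e2 e4 !reflD e0 e3.
by apply/ffunP => j; rewrite !ffunE; lia.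
Qed.

(* alpha_0 + 2 (alpha_m + ... + alpha_n) *)
Definition beta (m : nat) : rootLattice n :=
  [ffun j : I => if j == 0 :> nat then 1 else if (m <= j)%N then 2 else 0].

(** The pairing with the coroot of m is 2 in either case: vertex m gives 4, and its one neighbour
    with nonzero coefficient gives -2, as 1 * a_n0 for m = n and as 2 * a_(m,m+1) for m < n. *)
Lemma refl_beta m : (1 < m <= n)%N -> refl (nd m) (beta m) = beta m.+1.
Proof.
move=> hm; have [hm1 hm2] := andP hm.
have vm : nat_of_ord (nd m) = m by rewrite inordK.
have -> : refl (nd m) (beta m) = beta m - alpha (nd m) *~ 2.
  rewrite /refl; congr (_ - _ *~ _).
  have m0 : (m == 0)%N = false by lia.
  rewrite (bigD1 (nd m)) //= ffunE vm leqnn m0 {1}/cartan eqxx.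
  have [mn|mn] := eqVneq m n.
    rewrite (bigD1 (nd 0)) /=; last by rewrite inord_eq //; lia.
    rewrite ffunE inordK //= big1 => [|j /andP[]].
      by rewrite mn cartan_n0 //; lia.
    rewrite -!(inj_eq val_inj) /= vm inordK // => jm j0.
    rewrite ffunE (negbTE j0); have -> : (m <= j)%N = false by have := ltn_ord j; lia.
    by rewrite mul0r.
  rewrite (bigD1 (nd m.+1)) /=; last by rewrite inord_eq //; lia.
  rewrite ffunE inordK /=; last lia.
  rewrite leqnSn cartan_up; last lia.
  rewrite big1 // => j /andP[].
  rewrite -!(inj_eq val_inj) /= vm inordK; last lia.
  move=> jm jm1; rewrite ffunE.
  have [j0|j0] := eqVneq (j : nat) 0%N.
    by rewrite -[j]inord_val j0 cartan_far0 ?mulr0 //; lia.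
  case: leqP => mj; last by rewrite mul0r.
  have := ltn_ord j => jn; rewrite -[X in cartan _ X]inord_val.
  by rewrite cartan_far ?mulr0 //; lia.
apply/ffunP => j; rewrite -[2]/(2%:Z) -pmulrn mulr2n !ffunE -(inj_eq val_inj) /= vm.
have [->|j0] := eqVneq (j : nat) 0%N.
  by have -> : (m == 0)%N = false by lia.
have [<-|jm] := eqVneq m j; first by rewrite leqnn ltnn.
by rewrite leq_eqVlt (negbTE jm) subr0.
Qed.

Lemma beta_last : beta n.+1 = alpha (nd 0).
Proof.
apply/ffunP => j; rewrite !ffunE -(inj_eq val_inj) /= inordK // eq_sym.
have -> : (n < j)%N = false by have := ltn_ord j; lia.
by case: eqP.
Qed.

Lemma beta2 : (0 < n)%N -> beta 2 = delta n - alpha (nd 1) *+ 2.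
Proof.
move=> hn; apply/ffunP => j; rewrite mulr2n !ffunE -!(inj_eq val_inj) /= inordK //.
by case: (nat_of_ord j) => [|[|m]].
Qed.

End Reflections.

(** * The root vectors *)

Section Relations.
Variables (k : fieldType) (q : k) (n : nat) (A : algType k).
Local Notation I := 'I_n.+1.
Local Notation nd := (@inord n).
Variables (E F K Ki : I -> A) (T : I -> {lrmorphism A -> A}).
Variables (Tinv : I -> A -> A) (Om : A -> A).
Hypothesis H : braided q E F K Ki T Tinv Om.
Hypothesis hn : (0 < n)%N.
Local Notation ad := (ad E K Ki).
Local Notation Kl := (Kprod K Ki).

Let nd_neq i j : (i <= n)%N -> (j <= n)%N -> i != j -> nd i != nd j.
Proof. by move=> hi hj ij; rewrite inord_eq. Qed.

(* E_(delta-2alpha_1), F_(delta-2alpha_1), K_(delta-2alpha_1)^(+-1) and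
   E_(delta-alpha_1) *)
Definition Ed2 : A := iter n.-1 (cox T) (E (nd 0)).
Definition Fd2 : A := Om Ed2.
Definition Kd2 : A := Kl (delta n - alpha (nd 1) *+ 2).
Definition Kid2 : A := Kl (- (delta n - alpha (nd 1) *+ 2)).
Definition Ed1 : A := iter n (cox T) (Tinv (nd 1) (E (nd 1))).

Let X : A := chain T 2 n.-1 (E (nd 1)).

Let n_gt1 : n = 1%N \/ (1 < n)%N.
Proof. by lia. Qed.

Let pred_n1 : n = 1%N -> n.-1 = 0%N.
Proof. by lia. Qed.

Let q0 : q != 0 := br_q0 H.
Let q1 := br_q1 H.

Lemma qq0 : qq q (nd 0) = q ^+ 4.
Proof. by rewrite /qq dd_inord. Qed.
Lemma qq1 : qq q (nd 1) = q.
Proof. by rewrite /qq dd_inord // expr1. Qed.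

Let K_alpha i : Kl (alpha i) = K i := Kprod_alpha K Ki i.
Let K_alphaN i : Kl (- alpha i) = Ki i := Kprod_alphaN K Ki i.

Lemma KlD lam mu : Kl (lam + mu) = Kl lam * Kl mu.
Proof. exact: (KprodD (br_KKi H) (br_KiK H) (br_KK H)). Qed.

Lemma Kd2_KKi : Kd2 * Kid2 = 1.
Proof. by rewrite -KlD subrr Kprod0. Qed.
Lemma Kd2_KiK : Kid2 * Kd2 = 1.
Proof. by rewrite -KlD addNr Kprod0. Qed.
Lemma Kd2_K1 : Kd2 * K (nd 1) = K (nd 1) * Kd2.
Proof. by rewrite -K_alpha -!KlD addrC. Qed.
Lemma Kd2_delta : Kd2 = Kl (delta n) * Ki (nd 1) * Ki (nd 1).
Proof. by rewrite -K_alphaN -!KlD /Kd2 mulr2n opprD addrA. Qed.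
Lemma Kid2_delta : Kid2 = Kl (- delta n) * K (nd 1) * K (nd 1).
Proof. by rewrite -K_alpha -!KlD /Kid2 mulr2n opprB addrC addrA. Qed.

Lemma X_to_E1 : iter n.-1 (cox T) X = E (nd 1).
Proof.
have [n1|n1] := n_gt1; first by rewrite /X (pred_n1 n1).
apply: (iter_cox_chain H n1).
- by rewrite (T_far H) //; [apply: nd_neq; lia | apply: cartan_0far; lia].
- by move=> j hj; rewrite (T_far H) //; [apply: nd_neq; lia | apply: cartan_farr; lia].
apply: (T_lsl_short H).
- by apply: nd_neq; lia.
- exact: cartan12.
- by apply: cartan_down; lia.
by rewrite !dd_inord //; lia.
Qed.

(** T_n ... T_2 is injective and sends both sides to K_0: the left one by [chain_iter_cox], the
    right one along beta_2 = delta - 2 alpha_1, ..., beta_(n+1) = alpha_0. The action of c on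
    weights is thus never computed. *)
Lemma K0_to_Kd2 : iter n.-1 (cox T) (K (nd 0)) = Kd2.
Proof.
have [n1|n1] := n_gt1.
  rewrite /Kd2 -beta2 // (pred_n1 n1).
  by rewrite -[X in beta _ X](congr1 S n1) beta_last K_alpha.
have Tch m l : injective (chain T m l).
  elim: l => // l IH x y; rewrite !chainS => /(congr1 (Tinv (nd (m + l)))).
  by rewrite !(br_T H) => /IH.
apply: (Tch 2 n.-1); rewrite (chain_iter_cox H n1); last first.
- by rewrite -K_alpha !(br_TKl H) refl_n0n.
- by move=> j hj; rewrite -K_alpha (br_TKl H) refl_fix // cartan_far0.
have main l : (l <= n.-1)%N -> chain T 2 l Kd2 = Kl (beta n (2 + l)).
  elim: l => [|l IH] hl; first by rewrite addn0 beta2 //; lia.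
  by rewrite chainS IH ?(br_TKl H) ?refl_beta ?addnS //; lia.
by rewrite main // (_ : 2 + n.-1 = n.+1)%N ?beta_last ?K_alpha //; lia.
Qed.

Lemma Ed2_hdeg : (1 < n)%N -> hdeg (fun j => E (nd j)) (above n 2) 2 2 Ed2.
Proof.
move=> n1; apply: (hdeg_chain_inv H) => //; apply: (chain_iter_cox H n1).
- by move=> j hj; rewrite (T_far H) //; [apply: nd_neq; lia | apply: cartan_far0; lia].
apply: (T_sls_long H).
- by apply: nd_neq; lia.
- exact: cartan_n0.
- exact: cartan_0n.
rewrite !dd_inord // /ddn; have -> : (n == 0)%N = false by lia.
by have -> : (n == 1)%N = false by lia.
Qed.

Let above_far : (1 < n)%N ->
  forall j, above n 2 j -> nd 1 != nd j /\ cartan (nd 1) (nd j) = 0.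
Proof.
move=> n1 j [->|hj]; split; try by apply: nd_neq; lia.
  by apply: cartan_far0; lia.
by apply: cartan_far; lia.
Qed.

Let nd12 : (1 < n)%N -> nd 1 != nd 2.
Proof. by move=> n1; apply: nd_neq; lia. Qed.

Lemma Ed2_comm : Ed2 * F (nd 1) = F (nd 1) * Ed2.
Proof.
have [n1|n1] := n_gt1.
  by rewrite /Ed2 (pred_n1 n1) /=; apply: (EF_far H); apply: nd_neq; lia.
exact: (hdeg_commF H (above_far n1) (nd12 n1) (Ed2_hdeg n1)).
Qed.

Lemma Ed2_conjK : conjK (K (nd 1)) (Ki (nd 1)) Ed2 = q ^- 4 *: Ed2.
Proof.
have [n1|n1] := n_gt1.
  rewrite /Ed2 (pred_n1 n1) /=.
  by rewrite (conjK_E H) cartan_n1_10 // qq1.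
rewrite (hdeg_conjK H (above_far n1) (m := 2) (cartan12 n1) (Ed2_hdeg n1)).
by rewrite qq1 -exprVn -exprM exprVn.
Qed.

Lemma Ed2_ad : iter 5 (ad (nd 1)) Ed2 = 0.
Proof.
have [n1|n1] := n_gt1.
  rewrite /Ed2 (pred_n1 n1) /=.
  by apply: (ad_serre H (m := 4)); [apply: nd_neq; lia | exact: cartan_n1_10].
exact: (hdeg_ad H (above_far n1) (m := 2) (nd12 n1) (cartan12 n1) (Ed2_hdeg n1)).
Qed.

Let below_far j : below n j -> nd 0 != nd j /\ cartan (nd 0) (nd j) = 0.
Proof.
rewrite /below => hj; split; first by apply: nd_neq; lia.
exact: cartan_0far.
Qed.

Let nd0n : nd 0 != nd n.
Proof. by apply: nd_neq; lia. Qed.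

Let X_hdeg : hdeg (fun j => E (nd j)) (below n) n 1 X.
Proof.
have [n1|n1] := n_gt1; last exact: (hdeg_chain H).
rewrite /X (pred_n1 n1) /chain /= -[X in nd X]n1.
exact: (@hdeg_in _ _ (fun j => E (nd j))).
Qed.

Lemma X_conjK : conjK (K (nd 0)) (Ki (nd 0)) X = q ^- 4 *: X.
Proof.
rewrite (hdeg_conjK H below_far (m := 1) (cartan_0n hn) X_hdeg).
by rewrite qq0 !expr1.
Qed.

Lemma X_ad : iter 2 (ad (nd 0)) X = 0.
Proof. exact: (hdeg_ad H below_far (m := 1) nd0n (cartan_0n hn) X_hdeg). Qed.

Lemma X_T : T (nd 0) X = q ^- 4 *: (X * E (nd 0)) - E (nd 0) * X.
Proof.
rewrite (hdeg_T H below_far nd0n (m := 1) (cartan_0n hn) (erefl _) X_hdeg).2 //.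
by rewrite /ad /qad X_conjK -scalerAl opprB.
Qed.

(* Om is semilinear for an automorphism of k inverting q; [bar c c'] says that
   this automorphism maps c to c'. *)
Definition bar (c c' : k) : Prop := forall x, Om (c *: x) = c' *: Om x.

Lemma Om0 : Om 0 = 0.
Proof. by apply: (addrI (Om 0)); rewrite -(br_OmD H) !addr0. Qed.
Lemma OmN x : Om (- x) = - Om x.
Proof. by apply: (addrI (Om x)); rewrite -(br_OmD H) !subrr Om0. Qed.
Lemma OmB x y : Om (x - y) = Om x - Om y.
Proof. by rewrite (br_OmD H) OmN. Qed.
Lemma OmX x m : Om (x ^+ m) = Om x ^+ m.
Proof. by elim: m => [|m IH]; rewrite ?(br_Om1 H) // exprS (br_OmM H) IH -exprSr. Qed.
Lemma Om_sum m (f : 'I_m -> A) : Om (\sum_i f i) = \sum_i Om (f i).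
Proof. exact: (big_morph Om (br_OmD H) Om0). Qed.

Lemma bar1 : bar 1 1. Proof. by move=> x; rewrite !scale1r. Qed.
Lemma barq : bar q q^-1. Proof. exact: (br_OmZ H). Qed.
Lemma barM a a' b b' : bar a a' -> bar b b' -> bar (a * b) (a' * b').
Proof. by move=> ha hb x; rewrite -!scalerA ha hb. Qed.
Lemma barB a a' b b' : bar a a' -> bar b b' -> bar (a - b) (a' - b').
Proof. by move=> ha hb x; rewrite !scalerBl OmB ha hb. Qed.
Lemma barV a a' : a != 0 -> a' != 0 -> bar a a' -> bar a^-1 a'^-1.
Proof.
move=> a0 a0' ha x; apply: (scalerI a0').
by rewrite -ha !scalerA !mulfV // !scale1r.
Qed.
Lemma barX a a' m : bar a a' -> bar (a ^+ m) (a' ^+ m).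
Proof.
by move=> ha; elim: m => [|m IH]; [exact: bar1 | rewrite !exprS; exact: barM].
Qed.
Lemma barqn m : bar (q ^+ m) (q ^- m).
Proof. by rewrite -exprVn; apply: barX; exact: barq. Qed.
Lemma barqV m : bar (q ^- m) (q ^+ m).
Proof.
rewrite -[X in bar _ X]invrK; apply: barV; last exact: barqn.
  by rewrite expf_neq0.
by rewrite invr_neq0 // expf_neq0.
Qed.

Section BarQint.
Variable d : nat.
Hypothesis d0 : (0 < d)%N.
Let v := q ^+ d.
Let v0 : v != 0. Proof. exact: expf_neq0. Qed.
Let v1 m : (0 < m)%N -> v ^+ m != 1.
Proof. by move=> hm; rewrite -exprM q1 // muln_gt0 d0. Qed.

(** Inverting [v] changes the sign of numerator and denominator alike. *)
Lemma bar_qint m : bar (qint v m) (qint v m).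
Proof.
have hb j : bar (v ^+ j - v ^- j) (- (v ^+ j - v ^- j)).
  by rewrite opprB /v -exprM; apply: barB; [exact: barqn | exact: barqV].
have vv := qsub_neq0 v0 v1.
rewrite /qint -[X in bar _ X]mulrNN -[X in bar _ (_ * X)](invrN (v - v^-1)).
apply: barM; first exact: hb.
by apply: barV; rewrite ?oppr_eq0 //; have := hb 1%N; rewrite expr1.
Qed.

Lemma Om_divpow x m : Om (divpow v x m) = divpow v (Om x) m.
Proof.
rewrite /divpow -OmX; apply: barV; try exact: qfact_neq0 (qint_neq0 v0 v1) m.
elim: m => [|m IH]; first by rewrite /qfact big_geq //; exact: bar1.
by rewrite qfactS; apply: barM; last exact: bar_qint.
Qed.

(** [Om] reverses the products, and r -> m - r restores their order up to the sign (-1)^m. *)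
Lemma Om_serre m x y :
  \sum_(r < m.+1) (-1) ^+ r * (divpow v x r * y * divpow v x (m - r)) = 0 ->
  \sum_(r < m.+1) (-1) ^+ r * (divpow v (Om x) r * Om y * divpow v (Om x) (m - r)) = 0.
Proof.
have sgn r (z : A) : (-1) ^+ r * z = (-1) ^+ r *: z :> A.
  by rewrite -(signr_odd A) -(signr_odd k) mulr_sign scaler_sign.
have Omsgn r (z : A) : Om ((-1) ^+ r *: z) = (-1) ^+ r *: Om z.
  by rewrite -(signr_odd k r); case: (odd r); rewrite ?scaleN1r ?scale1r ?OmN.
move=> /(congr1 Om); rewrite Om0 Om_sum => h.
apply: (scalerI (a := (-1) ^+ m)); first by rewrite signr_eq0.
rewrite scaler0 -[RHS]h scaler_sumr (reindex_inj rev_ord_inj).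
apply: eq_bigr => -[r /= hr] _; rewrite ltnS in hr.
rewrite subSS subKn // !sgn Omsgn !(br_OmM H) !Om_divpow mulrA scalerA.
congr (_ *: _).
by rewrite -[X in _ ^+ X * _](subnKC hr) exprD -mulrA -expr2 sqrr_sign mulr1.
Qed.

End BarQint.

(** Applying [Om] reverses the relation and inverts [k0]; multiplying by [k0] on both sides restores
    its shape, with the conjugate scalar. *)
Lemma Om_conj (k0 k0i y : A) c c' : k0 * k0i = 1 -> k0i * k0 = 1 -> Om k0 = k0i ->
  bar c c' -> k0 * y = c *: (y * k0) -> k0 * Om y = c' *: (Om y * k0).
Proof.
move=> h1 h2 hO hc /(congr1 Om); rewrite hc !(br_OmM H) hO => h.
rewrite -[LHS]mulr1 -h2 !mulrA -(mulrA k0 (Om y)) h.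
by rewrite -scalerAr -scalerAl !mulrA h1 mul1r.
Qed.

End Relations.

(** * The relations of the image and its generators *)

Definition qserre (k : fieldType) (A : algType k) (v : k) (x y : A) (m : nat) : A :=
  \sum_(r < m.+1) (-1) ^+ r * (divpow v x r * y * divpow v x (m - r)).

Record A22_relations (k : fieldType) (q : k) (A : algType k)
    (E0 E1 F0 F1 K0 K1 K0i K1i : A) : Prop := A22Relations {
  A22r_K0K0i : K0 * K0i = 1;
  A22r_K0iK0 : K0i * K0 = 1;
  A22r_K1K1i : K1 * K1i = 1;
  A22r_K1iK1 : K1i * K1 = 1;
  A22r_K0K1 : K0 * K1 = K1 * K0;
  A22r_K1E1 : K1 * E1 = q ^+ 2 *: (E1 * K1);
  A22r_K1E0 : K1 * E0 = q ^- 4 *: (E0 * K1);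
  A22r_K0E1 : K0 * E1 = q ^- 4 *: (E1 * K0);
  A22r_K0E0 : K0 * E0 = q ^+ 8 *: (E0 * K0);
  A22r_K1F1 : K1 * F1 = q ^- 2 *: (F1 * K1);
  A22r_K1F0 : K1 * F0 = q ^+ 4 *: (F0 * K1);
  A22r_K0F1 : K0 * F1 = q ^+ 4 *: (F1 * K0);
  A22r_K0F0 : K0 * F0 = q ^- 8 *: (F0 * K0);
  A22r_E1F1 : E1 * F1 - F1 * E1 = (q - q^-1)^-1 *: (K1 - K1i);
  A22r_E0F0 : E0 * F0 - F0 * E0 = (q ^+ 4 - q ^- 4)^-1 *: (K0 - K0i);
  A22r_E1F0 : E1 * F0 - F0 * E1 = 0;
  A22r_E0F1 : E0 * F1 - F1 * E0 = 0;
  A22r_serreE01 : qserre (q ^+ 4) E0 E1 2 = 0;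
  A22r_serreE10 : qserre q E1 E0 5 = 0;
  A22r_serreF01 : qserre (q ^+ 4) F0 F1 2 = 0;
  A22r_serreF10 : qserre q F1 F0 5 = 0 }.

Lemma qserre_map (k : fieldType) (A : algType k) (g : {lrmorphism A -> A})
  (v : k) (x y : A) m : g (qserre v x y m) = qserre v (g x) (g y) m.
Proof.
rewrite /qserre rmorph_sum; apply: eq_bigr => r _.
rewrite !rmorphM /= rmorphXn rmorphN1 /divpow !linearZ /=.
by rewrite !rmorphXn.
Qed.

Section A22.
Variables (k : fieldType) (q : k) (n : nat) (A : algType k).
Local Notation I := 'I_n.+1.
Local Notation nd := (@inord n).
Variables (E F K Ki : I -> A) (T : I -> {lrmorphism A -> A}).
Variables (Tinv : I -> A -> A) (Om : A -> A).
Hypothesis H : braided q E F K Ki T Tinv Om.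
Hypothesis hn : (0 < n)%N.
Local Notation Ed2 := (Ed2 E T).
Local Notation Fd2 := (Fd2 E T Om).
Local Notation Kd2 := (Kd2 K Ki).
Local Notation Kid2 := (Kid2 K Ki).
Local Notation Ed1 := (Ed1 E T Tinv).
Let E1 := E (nd 1).
Let F1 := F (nd 1).
Let K1 := K (nd 1).
Let K1i := Ki (nd 1).
Let q0 : q != 0 := br_q0 H.
Let v0 : q ^+ 4 != 0. Proof. exact: expf_neq0. Qed.
Let v1 m : (0 < m)%N -> (q ^+ 4) ^+ m != 1.
Proof. by move=> hm; rewrite -exprM (br_q1 H) // muln_gt0. Qed.
Let X := chain T 2 n.-1 E1.

(* An endomorphism that maps the vertices (0, X) to (delta - 2 alpha_1, 1). *)
Let Phi : exists g : {lrmorphism A -> A},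
  [/\ g (E (nd 0)) = Ed2, g (F (nd 0)) = Fd2, g (K (nd 0)) = Kd2,
      g (Ki (nd 0)) = Kid2 & forall x, g x = iter n.-1 (cox T) x].
Proof.
have [g hg gOm] := iter_cox_lrmorphism H n.-1; exists g.
have gK : g (K (nd 0)) = Kd2 by rewrite hg (K0_to_Kd2 H hn).
split=> //; first by rewrite -(br_OmE H) gOm hg.
(* The image of K_0^-1 is found as the inverse of the image of K_0. *)
rewrite -[LHS]mulr1 -(Kd2_KKi H) mulrA -[X in _ * X * _]gK -rmorphM /=.
by rewrite (br_KiK H) rmorph1 mul1r.
Qed.

Lemma Ed2_K1 : K1 * Ed2 = q ^- 4 *: (Ed2 * K1).
Proof. exact: (conjK_scaleV (br_KiK H _) (Ed2_conjK H hn)). Qed.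

Lemma Kd2_E1 : Kd2 * E1 = q ^- 4 *: (E1 * Kd2).
Proof.
have [g [_ _ gK _ hg]] := Phi.
have gX : g X = E1 by rewrite hg (X_to_E1 H).
rewrite -gK -gX -!rmorphM /= (conjK_scaleV (br_KiK H _) (X_conjK H hn)).
by rewrite linearZ.
Qed.

Lemma Kd2_Ed2 : Kd2 * Ed2 = q ^+ 8 *: (Ed2 * Kd2).
Proof.
have [g [gE _ gK _ _]] := Phi; rewrite -gK -gE -!rmorphM /= (KE_same H).
by rewrite qq0 -exprM linearZ.
Qed.

Lemma Om_Kd2 : Om Kd2 = Kid2.
Proof.
have [g [_ _ gK gKi hg]] := Phi.
have [g' hg' gOm] := iter_cox_lrmorphism H n.-1.
by rewrite -gK -gKi !hg -!hg' -gOm (br_OmK H).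
Qed.

Lemma Ed2_Fd2 : Ed2 * Fd2 - Fd2 * Ed2 = (q ^+ 4 - q ^- 4)^-1 *: (Kd2 - Kid2).
Proof.
have [g [gE gF gK gKi _]] := Phi.
rewrite -gE -gF -gK -gKi -!rmorphM -!rmorphB /= (EF_same H) qq0.
by rewrite linearZ.
Qed.

Lemma E1_Fd2 : E1 * Fd2 = Fd2 * E1.
Proof. by have /(congr1 Om) := Ed2_comm H hn; rewrite !(br_OmM H) (br_OmF H). Qed.

Lemma serreE01 : qserre (q ^+ 4) Ed2 E1 2 = 0.
Proof.
have [g [gE _ _ _ hg]] := Phi.
have gX : g X = E1 by rewrite hg (X_to_E1 H).
rewrite -gE -gX -qserre_map -[RHS](rmorph0 g); congr (g _).
apply/(qad_serreP (br_KKi H (nd 0)) (br_KiK H (nd 0)) v0 _ (qsub_neq0 v0 v1)).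
- by rewrite -(qq0 q n) (KE_same H).
- exact: qint_neq0 v0 v1.
- by rewrite expr1 (X_conjK H hn).
exact: (X_ad H hn).
Qed.

Lemma serreE10 : qserre q E1 Ed2 5 = 0.
Proof.
have hq := br_q1 H.
apply/(qad_serreP (br_KKi H (nd 1)) (br_KiK H (nd 1)) q0 _ (qsub_neq0 q0 hq)).
- by rewrite -[q](qq1 q hn) (KE_same H) qq1.
- exact: qint_neq0 q0 hq.
- exact: (Ed2_conjK H hn).
exact: (Ed2_ad H hn).
Qed.

Lemma braided_A22 : A22_relations q Ed2 E1 Fd2 F1 Kd2 K1 Kid2 K1i.
Proof.
have OmE1 : Om E1 = F1 := br_OmE H _.
have K1E1 : K1 * E1 = q ^+ 2 *: (E1 * K1) by rewrite (KE_same H) qq1.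
have Kd2K := Kd2_KKi H; have KiKd2 := Kd2_KiK H.
have K1K := br_KKi H (nd 1); have KiK1 := br_KiK H (nd 1).
have OmK1 : Om K1 = K1i := br_OmK H _.
split => //.
- exact: (Kd2_K1 H).
- exact: Ed2_K1.
- exact: Kd2_E1.
- exact: Kd2_Ed2.
- by rewrite -OmE1; apply: (Om_conj H K1K KiK1 OmK1 (barqn H 2) K1E1).
- exact: (Om_conj H K1K KiK1 OmK1 (barqV H 4) Ed2_K1).
- by rewrite -OmE1; apply: (Om_conj H Kd2K KiKd2 Om_Kd2 (barqV H 4) Kd2_E1).
- exact: (Om_conj H Kd2K KiKd2 Om_Kd2 (barqn H 8) Kd2_Ed2).
- by rewrite (EF_same H) qq1.
- exact: Ed2_Fd2.
- by rewrite E1_Fd2 subrr.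
- by rewrite (Ed2_comm H hn) subrr.
- exact: serreE01.
- exact: serreE10.
- by rewrite -OmE1; apply: (Om_serre H (d := 4)) => //; exact: serreE01.
by rewrite -OmE1; apply: (Om_serre H (d := 1)) => //; exact: serreE10.
Qed.

Lemma Ed1E : Ed1 = q ^- 4 *: (E1 * Ed2) - Ed2 * E1.
Proof.
have [g [gE _ _ _ hg]] := Phi.
have gX : g X = E1 by rewrite hg (X_to_E1 H).
(* The rightmost factor T_1 of c cancels T_1^-1, leaving c^(n-1) T_0 T_n ... T_2 on E_1. *)
have -> : Ed1 = g (T (nd 0) X).
  rewrite hg /Ed1 /X /cox -[X in iter X](prednK hn) iterSr; congr (iter _ _ _).
  by rewrite -[X in chain T 1 X](prednK hn) chainSl (br_Tinv H).
rewrite (X_T H hn) rmorphB /= linearZ /= !rmorphM /= gE gX //.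
Qed.

(** The K_1^-1 terms cancel, because the coefficient q^-4 of the q-commutator offsets K_1^-1
    E_(delta-2alpha_1) = q^4 E_(delta-2alpha_1) K_1^-1; with K_1 the same factors multiply to
    q^-8. *)
Lemma Ed1_comm : Ed1 * F1 - F1 * Ed1 =
  ((q ^- 8 - 1) / (q - q^-1)) *: (Ed2 * K1).
Proof.
have KKi := br_KKi H (nd 1); have KiK := br_KiK H (nd 1).
have EF : E1 * F1 = F1 * E1 + (q - q^-1)^-1 *: (K1 - K1i).
  by rewrite addrC -[X in X - _^-1](qq1 q hn) -{2}(qq1 q hn) -(EF_same H) subrK.
have Ed2F : Ed2 * F1 = F1 * Ed2 := Ed2_comm H hn.
have KE := Ed2_K1.
have KiE : K1i * Ed2 = q ^+ 4 *: (Ed2 * K1i).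
  by rewrite (commKi KKi KiK _ KE) ?invrK // invr_neq0.
have q21 : q * q - 1 != 0 by rewrite subr_eq0 -expr2 (br_q1 H).
rewrite Ed1E; nc k A (EF, Ed2F, KE, KiE).
all: by field; rewrite ?q0 ?q21.
Qed.

(** This puts E_(delta-2alpha_1), which is not among the generators of [Uq1], into that subalgebra;
    the scalar can be inverted as q^8 != 1. *)
Lemma Ed2_from_Ed1 : exists c : k, Ed2 = c *: ((Ed1 * F1 - F1 * Ed1) * K1i).
Proof.
have c0 : (q ^- 8 - 1) / (q - q^-1) != 0.
  rewrite mulf_neq0 ?invr_neq0 ?(qsub_neq0 q0 (br_q1 H)) //.
  by rewrite subr_eq0 invr_eq1 (br_q1 H).
exists ((q ^- 8 - 1) / (q - q^-1))^-1.
by rewrite Ed1_comm -scalerAl scalerA mulVf // scale1r -mulrA (br_KKi H) mulr1.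
Qed.

Lemma Fd2_from_Fd1 : exists c : k, Fd2 = c *: (K1 * (E1 * Om Ed1 - Om Ed1 * E1)).
Proof.
(* [Om] is only semilinear, so the coefficient of [Ed1_comm] has to be conjugated before it is
   inverted. *)
have b : bar Om ((q ^- 8 - 1) / (q - q^-1)) ((q ^+ 8 - 1) / (q^-1 - q)).
  have vv := qsub_neq0 q0 (br_q1 H).
  apply: barM; first by apply: (barB H); [exact: (barqV H) | exact: bar1].
  apply: barV => //; first by rewrite -opprB oppr_eq0.
  apply: (barB H); first exact: (barq H).
  by have := barqV H 1; rewrite expr1.
have c0 : (q ^+ 8 - 1) / (q^-1 - q) != 0.
  rewrite mulf_neq0 // ?subr_eq0 ?(br_q1 H) // invr_eq0 -opprB oppr_eq0.
  exact: (qsub_neq0 q0 (br_q1 H)).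
have := congr1 Om Ed1_comm; rewrite (OmB H) b !(br_OmM H) (br_OmF H) (br_OmK H) => ->.
exists ((q ^+ 8 - 1) / (q^-1 - q))^-1.
by rewrite -scalerAr scalerA mulVf // scale1r mulrA (br_KKi H) mul1r.
Qed.

End A22.

(** * Return to the presented algebras *)

Lemma A22_feval (k : fieldType) (q : k) (A : algType k) (f : qgen 'I_2 -> A) :
  A22_relations q (f (gE ord0)) (f (gE ord_max)) (f (gF ord0)) (f (gF ord_max))
    (f (gK ord0)) (f (gK ord_max)) (f (gKi ord0)) (f (gKi ord_max)) ->
  forall l r, A22_rel q l r -> feval f l = feval f r.
Proof.
case; do 21![move=> ?] => l r; case.
all: move: (@fgen k (qgen 'I_2)) (@feval_gen k (qgen 'I_2) A f) => G evg.
18,19,20,21: by rewrite [LHS]feval_serre [RHS]feval0 !evg.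
1-4: by rewrite [LHS]fevalM feval1 !evg.
1: by rewrite [LHS]fevalM [RHS]fevalM !evg.
1-8: by rewrite [LHS]fevalM [RHS]fevalZ [X in _ *: X]fevalM !evg.
1-2: rewrite [LHS]fevalB [X in X - _ = _]fevalM [X in _ - X = _]fevalM.
1-2: by rewrite [RHS]fevalZ [X in _ *: X]fevalB !evg.
1-2: rewrite [LHS]fevalB [X in X - _ = _]fevalM [X in _ - X = _]fevalM.
1-2: by rewrite [RHS]feval0 !evg.
Qed.

Lemma subalg_genB (k : fieldType) (A : algType k) (S : A -> Prop) x y :
  subalg_gen S x -> subalg_gen S y -> subalg_gen S (x - y).
Proof.
by move=> hx hy; rewrite -scaleN1r; apply: subalg_genD => //; apply: subalg_genZ.
Qed.

Lemma subalg_comm (k : fieldType) (A : algType k) (S : A -> Prop) x y :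
  S x -> S y -> subalg_gen S (x * y - y * x).
Proof.
by move=> hx hy; apply: subalg_genB; apply: subalg_genM; exact: subalg_gen_in.
Qed.

Lemma presAlg_image (k : fieldType) (P : presentation k) (A : algType k)
    (phi : {lrmorphism presAlg P -> A}) (S : A -> Prop) :
  (forall x, subalg_gen S (phi (pgen x))) -> forall x, subalg_gen S (phi x).
Proof.
move=> hS; elim/presW=> x; rewrite -feval_pgen /feval /mmap rmorph_sum.
have S0 : subalg_gen S 0 by rewrite -(scale0r 1); apply/subalg_genZ/subalg_gen1.
apply: big_rec => // m y _ hy; apply: subalg_genD => //.
rewrite rmorphM /= rmorph_alg; apply: subalg_genM.
  exact/subalg_genZ/subalg_gen1.
rewrite rmorph_prod; apply: big_rec => [|g z _ hz]; first exact: subalg_gen1.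
by apply: subalg_genM => //; exact: hS.
Qed.

Lemma braid_action_braided (R : realType) (n : nat)
    (Om : UqA2n2 (qvar R) n -> UqA2n2 (qvar R) n)
    (T : 'I_n.+1 -> {lrmorphism UqA2n2 (qvar R) n -> UqA2n2 (qvar R) n})
    (Tinv : 'I_n.+1 -> UqA2n2 (qvar R) n -> UqA2n2 (qvar R) n) :
  is_Omega Om -> is_braid_action Om T Tinv ->
  braided (qvar R) (@UE _ (qvar R) n) (@UF _ (qvar R) n) (@UK _ (qvar R) n)
    (@UKi _ (qvar R) n) T Tinv Om.
Proof.
move=> hOm hT; split.
- exact: qvar_neq0.
- exact: qvar_exp_neq1.
- exact: UKKi.
- exact: UKiK.
- exact: UKK.
- exact: UKE.
- exact: UEF.
- exact: Userre.
- exact: (braid_K hT).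
- exact: (braid_Kinv hT).
- move=> i j x ij cij; have hc : coxeter i j = Some 2 by rewrite /coxeter cij mul0r.
  exact: (braid_rel hT ij hc x).
- move=> i j x ij cij cji.
  have hc : coxeter i j = Some 3 by rewrite /coxeter cij cji.
  exact: (braid_rel hT ij hc x).
- exact: (braid_Kl hT).
- exact: (braid_Ei hT).
- move=> i j m ij cij; have := braid_Ej hT ij.
  by have -> : absz (cartan i j) = m by rewrite cij abszN absz_nat.
- exact: (braid_Omega hT).
- exact: (Omega_add hOm).
- exact: (Omega_mul hOm).
- exact: (Omega_one hOm).
- exact: (Omega_q hOm).
- exact: (Omega_E hOm).
- exact: (Omega_F hOm).
- exact: (Omega_K hOm).
Qed.

Theorem proposition4p3p11 (R : realType) (n : nat) (hn : (1 <= n)%N)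
    (Om : UqA2n2 (qvar R) n -> UqA2n2 (qvar R) n)
    (T : 'I_n.+1 -> {lrmorphism UqA2n2 (qvar R) n -> UqA2n2 (qvar R) n})
    (Tinv : 'I_n.+1 -> UqA2n2 (qvar R) n -> UqA2n2 (qvar R) n)
    (hOm : is_Omega Om) (hT : is_braid_action Om T Tinv) :
  exists phi : {lrmorphism UqA22 (qvar R) -> UqA2n2 (qvar R) n},
    [/\ phi (A22E (qvar R) ord_max) = UE (qvar R) (vtx1 n),
        phi (A22F (qvar R) ord_max) = UF (qvar R) (vtx1 n),
        phi (A22K (qvar R) ord_max) = UK (qvar R) (vtx1 n) &
        phi (A22Ki (qvar R) ord_max) = UKi (qvar R) (vtx1 n)] /\
    [/\ phi (A22E (qvar R) ord0) = E_delta_2alpha1 T,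
        phi (A22F (qvar R) ord0) = F_delta_2alpha1 Om T,
        phi (A22K (qvar R) ord0) = UKl (qvar R) (delta n - alpha (vtx1 n) *+ 2) &
        phi (A22Ki (qvar R) ord0)
          = UKl (qvar R) (- (delta n - alpha (vtx1 n) *+ 2))] /\
    forall x, Uq1 Om T Tinv (phi x).
Proof.
have H := braid_action_braided hOm hT.
pose f (g : qgen 'I_2) : UqA2n2 (qvar R) n :=
  match g with
  | gE i => if i == ord0 then E_delta_2alpha1 T else UE (qvar R) (vtx1 n)
  | gF i => if i == ord0 then F_delta_2alpha1 Om T else UF (qvar R) (vtx1 n)
  | gK i => if i == ord0 then UKl (qvar R) (delta n - alpha (vtx1 n) *+ 2)
            else UK (qvar R) (vtx1 n)
  | gKi i => if i == ord0 then UKl (qvar R) (- (delta n - alpha (vtx1 n) *+ 2))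
             else UKi (qvar R) (vtx1 n)
  end.
have E0 : E_delta_2alpha1 T = Ed2 (@UE _ (qvar R) n) T.
  rewrite /E_delta_2alpha1 /Ed2.
  by have -> : ord0 = inord 0 :> 'I_n.+1 by apply/val_inj; rewrite /= inordK.
have F0 : F_delta_2alpha1 Om T = Fd2 (@UE _ (qvar R) n) T Om by rewrite /Fd2 -E0.
have hf : A22_relations (qvar R) (f (gE ord0)) (f (gE ord_max))
    (f (gF ord0)) (f (gF ord_max))
    (f (gK ord0)) (f (gK ord_max)) (f (gKi ord0)) (f (gKi ord_max)).
  by rewrite /f /= E0 F0; exact: (braided_A22 H hn).
have [phi hphi _] := @presAlg_universal _ (A22_pres (qvar R)) _ f (A22_feval hf).
exists phi; split; first by split; exact: hphi.
split; first by split; exact: hphi.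
apply: presAlg_image => g; rewrite hphi.
have gE1 := subalg_gen_in (Uq1_E1 Om T Tinv).
have gF1 := subalg_gen_in (Uq1_F1 Om T Tinv).
have gK1 := subalg_gen_in (Uq1_K1 Om T Tinv).
have gK1i := subalg_gen_in (Uq1_K1i Om T Tinv).
case: g => i; rewrite /f; case: eqP => _;
  [|exact: gE1| |exact: gF1| |exact: gK1| |exact: gK1i].
- rewrite E0; have [c ->] := Ed2_from_Ed1 H hn.
  apply: subalg_genZ; apply: (subalg_genM _ gK1i).
  exact: subalg_comm (Uq1_Ed Om T Tinv) (Uq1_F1 Om T Tinv).
- rewrite F0; have [c ->] := Fd2_from_Fd1 H hn.
  apply: subalg_genZ; apply: (subalg_genM gK1).
  exact: subalg_comm (Uq1_E1 Om T Tinv) (Uq1_Fd Om T Tinv).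
- have -> : UKl (qvar R) (delta n - alpha (vtx1 n) *+ 2) =
      UKl (qvar R) (delta n) * UKi (qvar R) (vtx1 n) * UKi (qvar R) (vtx1 n).
    exact: (Kd2_delta H).
  do 2![apply: (subalg_genM _ gK1i)].
  exact: subalg_gen_in (Uq1_Kd Om T Tinv).
have -> : UKl (qvar R) (- (delta n - alpha (vtx1 n) *+ 2)) =
    UKl (qvar R) (- delta n) * UK (qvar R) (vtx1 n) * UK (qvar R) (vtx1 n).
  exact: (Kid2_delta H).
do 2![apply: (subalg_genM _ gK1)].
exact: subalg_gen_in (Uq1_Kdi Om T Tinv).
Qed.
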